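(* Let $N$ be a lattice of rank $n$, let $F_\bullet$ be a complete flag in $N_{\mathbb Q}$, let $\Psi$ be the complement map induced by $F_\bullet$, and let $\mu$ be the associated Todd measure. Then for any cone $\sigma$ of dimension $k\ge 1$ in the domain of $\Psi$, $$\mu(\sigma)=\mu_k^{td_k}(\sigma)(F_{n-k+1}),$$ where $\mu_k^{td_k}(\sigma)$ is Morelli's rational function on the Grassmannian $Gr_{n-k+1}(N)$ of $(n-k+1)$-planes in $N$.
   Context: $M=\operatorname{Hom}(N,\mathbb Z)$; a subscript $\mathbb Q$ means tensoring with $\mathbb Q$. ''Cone'' means strictly convex rational polyhedral cone in $N_{\mathbb Q}$; $\tau\prec\sigma$ means $\tau$ is a face of $\sigma$. For a fan $\Sigma$ with toric variety $X$ (over $\mathbb C$), $V(\sigma)$ is the torus-orbit closure of $\sigma\in\Sigma$ and $Z_*(X)_{\mathbb Q}$ is the $\mathbb Q$-vector space with basis the cycles $[V(\sigma)]$, $\sigma\in\Sigma$. Complement map of a flag. A complete flag is $0=F_0\subset F_1\subset\dots\subset F_n=N_{\mathbb Q}$ with $\dim F_k=k$. The induced complement map is $\Psi(\sigma)=F_k$ for $\sigma$ of codimension $k$; its domain consists of the cones $\sigma$ generic with respect to $F_\bullet$, i.e. such that for every face $\tau\prec\sigma$ (including $\sigma$) $\operatorname{span}(\tau)$ is complementary to $F_{n-\dim\tau}$ in $N_{\mathbb Q}$. Ring structure. Let $\Sigma$ be a simplicial fan all of whose cones are in the domain of $\Psi$. A torus-invariant $\mathbb Q$-Cartier divisor $D$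 on $X$ has local equations $m_\sigma\in M_{\mathbb Q}$ for $\sigma$ a maximal cone of $\Sigma$: the coefficient of $V(\rho)$ in $D$, for a ray $\rho$ of $\sigma$ with first lattice point $v_\rho$, is $\langle m_\sigma,v_\rho\rangle$. For $\tau\in\Sigma$, let $\pi_\tau:M_{\mathbb Q}=\tau^\perp\oplus\Psi(\tau)^\perp\to\tau^\perp$ be the projection. $V(\tau)$ is the toric variety whose fan in $N_{\mathbb Q}/\operatorname{span}(\tau)$ consists of the cones $(\sigma+\operatorname{span}\tau)/\operatorname{span}\tau$, $\sigma\succ\tau$; let $D_\tau$ be the $\mathbb Q$-Cartier divisor on $V(\tau)$ with local equations $\pi_\tau(m_\sigma)$, and define $D\cdot[V(\tau)]=[D_\tau]\in Z_*(X)_{\mathbb Q}$. It is known that this extends to a well-defined commutative ring structure on $Z_*(X)_{\mathbb Q}$ with unit $[V(\{0\})]=[X]$, for which the product of the class of $D$ with $[V(\tau)]$ is $D\cdot[V(\tau)]$. Todd measure. A cone is non-singular if the first lattice points along its extreme rays form a basis of the lattice $N\cap\operatorname{span}$ of the cone; a fan is non-singular if all its cones are. For a non-singular fan $\Sigma'$ with cones in the domain of $\Psi$, with rays $\rho_1,\dots,\rho_r$ and $D_i$ the divisor $V(\rho_i)$, put $t_\Psi(X')=\prod_{i=1}^r\frac{D_i}{1-\exp(-D_i)}$, evaluated in $Z_*(X')_{\mathbb Q}$. If $\Sigma'$ is a subdivision of $\Sigma$ and $\pi:X'\to X$ the induced map, $\pi_*:Z_*(X')_{\mathbb Q}\to Z_*(X)_{\mathbb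 Q}$ sends $[V(\sigma')]$ to $[V(\sigma)]$ if the smallest cone $\sigma$ of $\Sigma$ containing $\sigma'$ has the same dimension as $\sigma'$, and to $0$ otherwise. The Todd measure $\mu(\sigma)\in\mathbb Q$ is the coefficient of $[V(\sigma)]$ in $\pi_*(t_\Psi(X'))$, for any fan $\Sigma$ containing $\sigma$ and any non-singular subdivision $\Sigma'$ of $\Sigma$ with all cones in the domain of $\Psi$; it depends only on $\sigma$ (and $\Psi$). Morelli's function. Let $td_k(x_1,\dots,x_k)$ be the homogeneous degree $k$ part of $\prod_{i=1}^k\frac{x_i}{1-\exp(-x_i)}$. For a non-singular $k$-dimensional cone $\sigma$ with first lattice points $v_1,\dots,v_k$ along its rays, and a generic $(n-k+1)$-plane $E$, the intersection $E\cap\operatorname{span}(\sigma)$ is a line spanned by a vector $\sum_i t_iv_i$ with all $t_i\neq0$, and $\mu_k^{td_k}(\sigma)(E)=\frac{td_k(t_1,\dots,t_k)}{t_1\cdots t_k}$. The assignment is additive: for an arbitrary $k$-dimensional cone $\sigma$, $\mu_k^{td_k}(\sigma)=\sum_j\mu_k^{td_k}(\tau_j)$, where the $\tau_j$ are the $k$-dimensional cones of a non-singular subdivision of $\sigma$; the resulting rational function is independent of the subdivision, and its value at $E$ is computed from any non-singular subdivision of $\sigma$ each of whose $k$-dimensional cones $\tau_j$ is generic with respect to $E$, meaning that $E\cap\operatorname{span}(\tau_j)$ is a line spanned by a vector $\sum_i t_iw_i$ with all $t_i\neq0$, where $w_1,\dots,w_k$ are the first lattice points along the rays of $\tau_j$.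 *)

(* Defs.v *)
From mathcomp Require Import all_boot all_order all_algebra.
From mathcomp Require Import boolp classical_sets.

Set Implicit Arguments.
Unset Strict Implicit.
Unset Printing Implicit Defensive.

Import Order.TTheory GRing.Theory Num.Theory.
Local Open Scope classical_set_scope.
Local Open Scope ring_scope.

(** Conventions (MathComp, with classical sets): the lattice is N = Z^n, inside
    N_Q = 'rV[rat]_n; the dual space M_Q is 'cV[rat]_n.  A cone is a subset of
    N_Q, a linear subspace is a {vspace}. *)

Section Cones.
Variable n : nat.
Implicit Types (C T : set 'rV[rat]_n) (U : {vspace 'rV[rat]_n})
  (v w : 'rV[rat]_n) (m : 'cV[rat]_n).

Definition lattice : set 'rV[rat]_n := [set v | forall i, v 0 i \is a Num.int].

Definition pairing m v : rat := (v *m m) 0 0.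

Definition perp U : {vspace 'cV[rat]_n} :=
  (\bigcap_(v <- vbasis U) lker (linfun (mulmx v : 'cV[rat]_n -> 'M_1)))%VS.

Definition cone_hull (s : seq 'rV[rat]_n) : set 'rV[rat]_n :=
  [set v | exists2 c : 'I_(size s) -> rat,
     (forall i, 0 <= c i) & v = \sum_i c i *: s`_i].

(* Rationality is automatic: a vector of Q^n has a positive multiple in Z^n. *)
Definition is_cone C : Prop :=
  (exists s, C = cone_hull s) /\ (forall v, C v -> C (- v) -> v = 0).

(* The least subspace containing C (see cspan_min). *)
Definition cspan C : {vspace 'rV[rat]_n} :=
  xget 0%VS [set U : {vspace 'rV[rat]_n} | C `<=` [set` U] /\
                     forall W : {vspace 'rV[rat]_n}, C `<=` [set` W] -> (U <= W)%VS].

Definition cdim C : nat := \dim (cspan C).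

Definition is_face T C : Prop :=
  exists2 m, (forall v, C v -> 0 <= pairing m v)
           & T = C `&` [set v | pairing m v = 0].

(* v represents the first lattice point of the ray (C + U) / U with respect to
   the lattice N / (N `&` U). *)
Definition first_lattice_point_mod U C v : Prop :=
  let CU : set 'rV[rat]_n := [set x + y | x in C & y in [set` U]] in
  [/\ lattice v, CU v, v \notin U &
      forall w, lattice w -> CU w -> exists a : nat, w - v *+ a \in U].

Definition first_lattice_point : set 'rV[rat]_n -> 'rV[rat]_n -> Prop :=
  first_lattice_point_mod 0%VS.

Definition is_ray_gens C (s : seq 'rV[rat]_n) : Prop :=
  uniq s /\
  forall v, v \in s <->
    exists T, [/\ is_face T C, cdim T = 1%N & first_lattice_point T v].

Definition is_lattice_basis U (s : seq 'rV[rat]_n) : Prop :=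
  (forall v, v \in s -> lattice v /\ v \in U) /\
  forall v, lattice v -> v \in U ->
    exists! a : {ffun 'I_(size s) -> int}, v = \sum_i (a i)%:~R *: s`_i.

Definition nonsingular C : Prop :=
  exists2 s, is_ray_gens C s & is_lattice_basis (cspan C) s.

End Cones.

Section Flags.
Variables (n : nat) (F : nat -> {vspace 'rV[rat]_n}).

(* Only F 0, ..., F n matter; dimensions force F 0 = 0 and F n = N_Q. *)
Definition complete_flag : Prop :=
  (forall k, (k <= n)%N -> \dim (F k) = k) /\
  (forall k, (k < n)%N -> (F k <= F k.+1)%VS).

Definition complement_map (C : set 'rV[rat]_n) : {vspace 'rV[rat]_n} :=
  F (n - cdim C).

Definition in_domain (C : set 'rV[rat]_n) : Prop :=
  forall T, is_face T C ->
    (cspan T + complement_map T)%VS = fullv /\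
    (cspan T :&: complement_map T)%VS = 0%VS.

(* Projection of M_Q onto (span T)^perp along Psi(T)^perp. *)
Definition flag_proj (T : set 'rV[rat]_n) : 'cV[rat]_n -> 'cV[rat]_n :=
  daddv_pi (perp (cspan T)) (perp (complement_map T)).

End Flags.

Record fan (n : nat) := Fan {
  fan_index :> finType;
  fan_cone : fan_index -> set 'rV[rat]_n;
  fan_inhabited : (0 < #|fan_index|)%N;
  fan_injective : injective fan_cone;
  fan_is_cone : forall s, is_cone (fan_cone s);
  fan_face : forall s T, is_face T (fan_cone s) -> exists t, fan_cone t = T;
  fan_inter : forall s t, is_face (fan_cone s `&` fan_cone t) (fan_cone s)
}.

Definition support n (X : fan n) : set 'rV[rat]_n :=
  [set v | exists s : X, fan_cone s v].

Definition fan_subdivides n (X' X : fan n) : Prop :=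
  support X' = support X /\
  forall s' : X', exists s : X, fan_cone s' `<=` fan_cone s.

(* That is, a subdivision of the fan of all faces of C. *)
Definition subdivides_cone n (X' : fan n) (C : set 'rV[rat]_n) : Prop :=
  support X' = C.

Definition nonsingular_fan n (X : fan n) : Prop :=
  forall s : X, nonsingular (fan_cone s).

Definition maximal_cone n (X : fan n) (s : X) : Prop :=
  forall t : X, fan_cone s `<=` fan_cone t -> t = s.

Section Cycles.
Variables (n : nat) (X : fan n).

Definition cycles := {ffun X -> rat^o}.

Definition orbit_closure (s : X) : cycles := [ffun t => (t == s)%:R].

Definition fundamental_cycle : cycles :=
  [ffun t => `[< fan_cone t = [set 0] >]%:R].

(* D is a divisor with local equation m s on each maximal cone s; the values of
   m on non-maximal cones are irrelevant. *)
Definition local_equations (D : cycles) (m : X -> 'cV[rat]_n) : Prop :=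
  (forall r, cdim (fan_cone r) <> 1%N -> D r = 0) /\
  (forall s r v, maximal_cone s -> is_face (fan_cone r) (fan_cone s) ->
     cdim (fan_cone r) = 1%N -> first_lattice_point (fan_cone r) v ->
     D r = pairing (m s) v).

(* z is the cycle [D_t], where D_t is the divisor on V(t) with local equations
   flag_proj F t (m s), for s maximal containing t: the rays of the fan of V(t)
   are the images of the cones r having t as a facet, and the corresponding
   divisors of V(t) are the V(r). *)
Definition is_restricted_divisor (F : nat -> {vspace 'rV[rat]_n})
    (m : X -> 'cV[rat]_n) (t : X) (z : cycles) : Prop :=
  let facet r := is_face (fan_cone t) (fan_cone r) /\
                 cdim (fan_cone r) = (cdim (fan_cone t)).+1 in
  (forall r, ~ facet r -> z r = 0) /\
  (forall r s u, facet r -> maximal_cone s -> is_face (fan_cone r) (fan_cone s) ->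
     first_lattice_point_mod (cspan (fan_cone t)) (fan_cone r) u ->
     z r = pairing (flag_proj F (fan_cone t) (m s)) u).

(* mul is the ring structure on cycles determined by the flag F. *)
Record is_cycle_product (F : nat -> {vspace 'rV[rat]_n})
    (mul : cycles -> cycles -> cycles) : Prop := IsCycleProduct {
  cycle_mulA : associative mul;
  cycle_mulC : commutative mul;
  cycle_mul1 : left_id fundamental_cycle mul;
  cycle_mul_linear : forall z, linear (mul z);
  cycle_mul_divisor : forall D m t, local_equations D m ->
    is_restricted_divisor F m t (mul D (orbit_closure t))
}.

End Cycles.

Definition pushforward n (X' X : fan n) (z : cycles X') : cycles X :=
  [ffun s => \sum_(s' : X' | `[< [/\ fan_cone s' `<=` fan_cone s,
       (forall t : X, fan_cone s' `<=` fan_cone t -> fan_cone s `<=` fan_cone t)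
       & cdim (fan_cone s) = cdim (fan_cone s')] >]) z s'].

(* The first j Taylor coefficients of x / (1 - exp (- x)), obtained by inverting
   (1 - exp (- x)) / x = \sum_i (-1)^i x^i / (i+1)!; see todd_coefP. *)
Fixpoint todd_coefs (j : nat) : seq rat :=
  if j is j'.+1 then
    rcons (todd_coefs j')
      ((j' == 0%N)%:R -
         \sum_(i < j') (todd_coefs j')`_i * ((-1) ^+ (j' - i) / (j' - i).+1`!%:R))
  else [::].

Definition todd_coef (j : nat) : rat := (todd_coefs j.+1)`_j.

(* td_k, the homogeneous part of degree k of \prod_(i < k) x_i / (1 - exp (- x_i)). *)
Definition td (k : nat) (x : 'I_k -> rat) : rat :=
  \sum_(a : {ffun 'I_k -> 'I_k.+1} | (\sum_i a i)%N == k)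
     \prod_i (todd_coef (a i) * x i ^+ a i).

(* \prod_i D_i / (1 - exp (- D_i)) over the rays.  Multiplication by D_i sends
   V(t) to cycles of dimension one less, so D_i^j = 0 for j > n and the series
   may be truncated after degree n. *)
Definition todd_class n (X : fan n) (mul : cycles X -> cycles X -> cycles X) :
    cycles X :=
  \big[mul/fundamental_cycle X]_(r : X | `[< cdim (fan_cone r) = 1%N >])
     \sum_(j < n.+1)
        todd_coef j *: iter j (mul (orbit_closure r)) (fundamental_cycle X).

(* q is the Todd measure of C, computed from some fan X containing C and some
   nonsingular subdivision X' of X with all cones in the domain of Psi.  The
   relation (rather than a function) leaves the measure undefined when there is
   no such X'. *)
Definition is_todd_measure n (F : nat -> {vspace 'rV[rat]_n})
    (C : set 'rV[rat]_n) (q : rat) : Prop :=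
  exists (X X' : fan n) (s : X) (mul : cycles X' -> cycles X' -> cycles X'),
    [/\ fan_cone s = C,
        fan_subdivides X' X /\ nonsingular_fan X',
        (forall s' : X', in_domain F (fan_cone s')),
        is_cycle_product F mul &
        q = pushforward X (todd_class mul) s].

(* For nonsingular C of dimension k: C is generic with respect to E, and
   q = td_k(t) / (t_1 ... t_k). *)
Definition is_morelli_nonsingular n k (C : set 'rV[rat]_n)
    (E : {vspace 'rV[rat]_n}) (q : rat) : Prop :=
  exists (w : k.-tuple 'rV[rat]_n) (t : 'I_k -> rat),
    [/\ is_ray_gens C w,
        (E :&: cspan C)%VS = <[\sum_i t i *: tnth w i]>%VS,
        (forall i, t i != 0) &
        q = td t / \prod_i t i].

(* X' is a nonsingular subdivision of C whose k-dimensional cones are generic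
   with respect to E, and q is the sum of Morelli's function over them. *)
Definition morelli_sum n k (X' : fan n) (C : set 'rV[rat]_n)
    (E : {vspace 'rV[rat]_n}) (q : rat) : Prop :=
  [/\ subdivides_cone X' C, nonsingular_fan X' &
      exists2 val : X' -> rat,
        (forall s, cdim (fan_cone s) = k ->
           is_morelli_nonsingular k (fan_cone s) E (val s)) &
        q = \sum_(s : X' | cdim (fan_cone s) == k) val s].

(* Morelli's rational function of the k-dimensional cone C has at E the value q:
   some subdivision computes it (see morelli_sum), and every such one gives q. *)
Definition is_morelli_value n k (C : set 'rV[rat]_n)
    (E : {vspace 'rV[rat]_n}) (q : rat) : Prop :=
  (exists (X' : fan n) r, morelli_sum k X' C E r) /\
  (forall (X' : fan n) r, morelli_sum k X' C E r -> r = q).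

Lemma cspan_hull n (s : seq 'rV[rat]_n) : cspan (cone_hull s) = <<s>>%VS.
Proof.
have sub : cone_hull s `<=` [set` <<s>>%VS].
  move=> v [c _ ->] /=; apply: memv_suml => i _.
  by rewrite memvZ // memv_span // mem_nth.
have min (W : {vspace 'rV[rat]_n}) :
    cone_hull s `<=` [set` W] -> (<<s>> <= W)%VS.
  move=> sW; apply/span_subvP => v /(nthP 0) [i lti <-].
  apply: (sW) => /=; exists (fun j => (j == Ordinal lti)%:R).
    by move=> j; rewrite ler0n.
  rewrite (bigD1 (Ordinal lti)) //= eqxx scale1r big1 ?addr0 // => j /negPf ->.
  by rewrite scale0r.
rewrite /cspan; case: xgetP => [U _ [sU minU] | none].
  by apply/eqP; rewrite eqEsubv minU ?min.
by case: (none <<s>>%VS).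
Qed.

Lemma cspan_min n (C : set 'rV[rat]_n) : is_cone C ->
  C `<=` [set` cspan C] /\
  forall W : {vspace 'rV[rat]_n}, C `<=` [set` W] -> (cspan C <= W)%VS.
Proof.
move=> [[s ->] _]; rewrite cspan_hull; split=> [v [c _ ->] | W sW].
  by apply: memv_suml => i _; rewrite memvZ // memv_span // mem_nth.
apply/span_subvP => v /(nthP 0) [i lti <-].
apply: (sW) => /=; exists (fun j => (j == Ordinal lti)%:R).
  by move=> j; rewrite ler0n.
rewrite (bigD1 (Ordinal lti)) //= eqxx scale1r big1 ?addr0 // => j /negPf ->.
by rewrite scale0r.
Qed.

Lemma perpP n (U : {vspace 'rV[rat]_n}) (m : 'cV[rat]_n) :
  m \in perp U <-> forall v, v \in U -> pairing m v = 0.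
Proof.
have -> : m \in perp U =
    all (fun v => m \in lker (linfun (mulmx v : 'cV[rat]_n -> 'M_1))) (vbasis U).
  rewrite /perp; elim: (tval (vbasis U)) => [|v s IH] /=.
    by rewrite big_nil memvf.
  by rewrite big_cons memv_cap IH.
split=> [/allP perpm v /coord_vbasis -> | perpm].
  rewrite /pairing mulmx_suml summxE; apply: big1 => i _.
  have /perpm : (vbasis U)`_i \in (vbasis U : seq _) by rewrite mem_nth ?size_tuple.
  by rewrite memv_ker lfunE /= -scalemxAl => /eqP ->; rewrite scaler0 mxE.
apply/allP => v /vbasis_mem /perpm pmv; rewrite memv_ker lfunE /=.
by apply/eqP/matrixP => i j; rewrite !ord1 [RHS]mxE.
Qed.

Lemma size_todd_coefs j : size (todd_coefs j) = j.
Proof. by elim: j => //= j IH; rewrite size_rcons IH. Qed.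

Lemma nth_todd_coefs j i : (i < j)%N -> (todd_coefs j)`_i = todd_coef i.
Proof.
elim: j => // j IH; rewrite ltnS leq_eqVlt => /orP [/eqP -> // | lt].
by rewrite /= nth_rcons size_todd_coefs lt IH.
Qed.

Lemma todd_coefP j :
  \sum_(i < j.+1) todd_coef i * ((-1) ^+ (j - i) / (j - i).+1`!%:R) =
  (j == 0%N)%:R :> rat.
Proof.
rewrite big_ord_recr /= subnn expr0 (_ : 1 / _ = 1) // mulr1.
rewrite [todd_coef j]/todd_coef /=.
rewrite nth_rcons size_todd_coefs ltnn eqxx addrC.
rewrite (eq_bigr (fun i : 'I_j => todd_coef i * ((-1) ^+ (j - i) / (j - i).+1`!%:R))).
  by rewrite subrK.
by move=> i _; rewrite nth_todd_coefs.
Qed.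

(* Main.v *)
(** Let w be a cone of dimension k of a nonsingular fan in the domain of Psi, and
    let u = \sum_i t_i v_i span the line F_(n-k+1) :&: span w.  Projecting along
    Psi(tau)^perp does not change the value of a linear form at u when tau is a
    facet of w, so the coefficient of [V(w)] in D_r . Z is t_r times a quantity
    that depends on Z only.  By commutativity the coefficient of [V(w)] in a
    monomial of degree k in the D_r is therefore proportional to the value of the
    monomial at t; the product of the rays of w has coefficient 1, so the constant
    is 1 / (t_1 ... t_k), and the coefficient in the Todd class is
    td_k(t) / (t_1 ... t_k).  Summing over the k-dimensional cones inside sigma
    gives the Todd measure as a Morelli sum.

    Two Morelli sums agree because td_k(t) / (t_1 ... t_k) is the constant term at
    z = 0 of \prod_i 1 / (1 - q^t_i), where q = exp(-z).  Expanding this in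
    positive powers of q, a point m of the dual lattice contributes q^m(u) with
    coefficient \prod_i ([t_i > 0] - [m(v_i) < 0]).  Multiplying out and summing
    over the cones of the subdivision leaves, for each cone rho, the sign
    (-1)^(dim rho) if m < 0 on the rays of rho and sigma contains x + eps u for x
    in the interior of rho and small eps > 0.  By Farkas' lemma and
    inclusion-exclusion this reduces to the sums of (-1)^(dim rho) over the rho in
    a face of sigma with m < 0 on the rays of rho, and such a sum is 1 or 0
    according to whether m >= 0 on that face.  Hence the expansion depends on
    sigma and u only. *)

Require Import Defs.
From HB Require Import structures.
From mathcomp Require Import all_boot all_order all_algebra.
From mathcomp Require Import boolp classical_sets.
From mathcomp Require Import ring lra zify.

Set Implicit Arguments.
Unset Strict Implicit.
Unset Printing Implicit Defensive.

Import Order.TTheory GRing.Theory Num.Theory.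
Local Open Scope classical_set_scope.
Local Open Scope ring_scope.

(** * Rational cones *)

Section Pairing.
Variable n : nat.
Implicit Types (v w x : 'rV[rat]_n) (m : 'cV[rat]_n).

Lemma pairingDr m v w : pairing m (v + w) = pairing m v + pairing m w.
Proof. by rewrite /pairing mulmxDl mxE. Qed.

Lemma pairingZr m a v : pairing m (a *: v) = a * pairing m v.
Proof. by rewrite /pairing -scalemxAl mxE. Qed.

Lemma pairing0r m : pairing m 0 = 0.
Proof. by rewrite /pairing mul0mx mxE. Qed.

Lemma pairingNr m v : pairing m (- v) = - pairing m v.
Proof. by rewrite -scaleN1r pairingZr mulN1r. Qed.

Lemma pairingBr m v w : pairing m (v - w) = pairing m v - pairing m w.
Proof. by rewrite pairingDr pairingNr. Qed.

Lemma pairing_sumr m (I : Type) (r : seq I) (P : pred I) (f : I -> 'rV_n) :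
  pairing m (\sum_(i <- r | P i) f i) = \sum_(i <- r | P i) pairing m (f i).
Proof. by rewrite /pairing mulmx_suml summxE. Qed.

Lemma pairingDl m1 m2 v : pairing (m1 + m2) v = pairing m1 v + pairing m2 v.
Proof. by rewrite /pairing mulmxDr mxE. Qed.

Lemma pairingZl a m v : pairing (a *: m) v = a * pairing m v.
Proof. by rewrite /pairing -scalemxAr mxE. Qed.

Lemma pairing0l v : pairing 0 v = 0.
Proof. by rewrite /pairing mulmx0 mxE. Qed.

Lemma pairing_suml (I : Type) (r : seq I) (P : pred I) (f : I -> 'cV_n) v :
  pairing (\sum_(i <- r | P i) f i) v = \sum_(i <- r | P i) pairing (f i) v.
Proof. by rewrite /pairing mulmx_sumr summxE. Qed.

Lemma pairing_represent (f : 'rV[rat]_n -> rat) :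
  (forall a x y, f (a *: x + y) = a * f x + f y) ->
  exists m, forall x, pairing m x = f x.
Proof.
move=> flin; exists (\col_i f (delta_mx 0 i)) => x.
have f0 : f 0 = 0 by move: (flin (-1) 0 0); rewrite scaler0 add0r => ->; ring.
rewrite [in RHS](row_sum_delta x).
rewrite (big_morph f (id1 := 0) (op1 := +%R)) //; last first.
  by move=> y z; rewrite -[y in LHS]scale1r flin mul1r.
rewrite /pairing mxE; apply: eq_bigr => i _; rewrite mxE.
by rewrite -[_ *: _]addr0 flin f0 addr0.
Qed.

End Pairing.

(** * Arbitrarily small positive perturbations *)

Section Eventually.

(** An index [k] stands for the positive number [tiny k], so this quantifies over all sufficiently
    small perturbations along a fixed sequence tending to 0. *)
Definition eventually (P : nat -> Prop) := exists N, forall k, (N <= k)%N -> P k.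

Lemma eventually_and P Q :
  eventually P -> eventually Q -> eventually (fun k => P k /\ Q k).
Proof.
move=> [N PN] [N' QN']; exists (maxn N N') => k; rewrite geq_max => /andP[lk lk'].
by split; [apply: PN | apply: QN'].
Qed.

Lemma eventually_all (I : finType) (P : I -> nat -> Prop) :
  (forall i, eventually (P i)) -> eventually (fun k => forall i, P i k).
Proof.
move=> evP; have /choice[N PN] := evP.
exists (\max_i N i) => k lk i; apply: PN; apply: leq_trans lk.
exact: (leq_bigmax i).
Qed.

(** If each of the finitely many alternatives failed from some index on, all would fail together at
    a common index. *)
Lemma frequently_pigeonhole (I : finType) (P : I -> nat -> Prop) :
  (forall k, exists i, P i k) ->
  exists i, forall N, exists2 k, (N <= k)%N & P i k.
Proof.
move=> exP; apply: contrapT => none.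
have [|N evN] := @eventually_all I (fun i k => ~ P i k).
  move=> i; apply: contrapT => nev; apply: none; exists i => N.
  apply: contrapT => nP; apply: nev; exists N => k lk Pik.
  by apply: nP; exists k.
by have [i Pi] := exP N; case: (evN N (leqnn N) i).
Qed.

Definition tiny (k : nat) : rat := k.+1%:R^-1.

Lemma tiny_gt0 k : 0 < tiny k.
Proof. by rewrite invr_gt0 ltr0n. Qed.

Lemma tiny_inj : injective tiny.
Proof. by move=> j k /invr_inj /eqP; rewrite eqr_nat => /eqP[]. Qed.

Lemma tiny_small (e : rat) : 0 < e -> eventually (fun k => tiny k < e).
Proof.
move=> e0; have := archi_boundP (ltW (_ : 0 < e^-1)); rewrite invr_gt0 => /(_ e0).
set N := Num.bound _ => lN; exists N => k lk.
rewrite /tiny invf_plt ?posrE ?ltr0n //; apply: lt_le_trans lN _.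
by rewrite ler_nat leqW.
Qed.

Lemma eventually_pos (a b : rat) : 0 < a -> eventually (fun k => 0 < a + tiny k * b).
Proof.
move=> a0; have [b0|b0] := leP 0 b.
  exists 0%N => k _; apply: ltr_wpDr => //.
  by rewrite mulr_ge0 // ltW ?tiny_gt0.
have nb0 : 0 < - b by rewrite oppr_gt0.
have [N lN] := tiny_small (divr_gt0 a0 nb0); exists N => k /lN.
by rewrite ltr_pdivlMr // mulrN -subr_gt0 opprK.
Qed.

Lemma frequently_ge0 (a b : rat) (P : nat -> Prop) :
  (forall N, exists2 k, (N <= k)%N & P k) ->
  (forall k, P k -> 0 <= a + tiny k * b) -> 0 <= a.
Proof.
move=> freq Pge; have [//|a0] := leP 0 a.
have na0 : 0 < - a by rewrite oppr_gt0.
have [N lN] := eventually_pos (- b) na0; have [k /lN + /Pge] := freq N.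
by rewrite mulrN -opprD oppr_gt0 => /lt_geF ->.
Qed.

End Eventually.

(** * Finitely generated cones and Farkas' lemma *)

Section Farkas.
Variable n : nat.
Implicit Types (s : seq 'rV[rat]_n) (u g x : 'rV[rat]_n) (m : 'cV[rat]_n).

Lemma cone_hull0 s : cone_hull s 0.
Proof. by exists (fun=> 0) => //; rewrite big1 // => i _; rewrite scale0r. Qed.

Lemma cone_hull_cons g s x :
  cone_hull (g :: s) x <-> exists a y, [/\ 0 <= a, cone_hull s y & x = a *: g + y].
Proof.
split=> [[c c0 ->]|[a [y [a0 [c c0 ->] ->]]]].
  rewrite big_ord_recl /=; exists (c ord0), (\sum_i c (lift ord0 i) *: s`_i).
  by split=> //; exists (fun i => c (lift ord0 i)).
exists (fun i => if unlift ord0 i is Some j then c j else a).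
  by move=> i; case: (unlift _ _).
rewrite big_ord_recl unlift_none; congr (_ + _).
by apply: eq_bigr => i _; rewrite liftK.
Qed.

Lemma cone_hullD s x y : cone_hull s x -> cone_hull s y -> cone_hull s (x + y).
Proof.
move=> [c c0 ->] [d d0 ->]; exists (fun i => c i + d i).
  by move=> i; rewrite addr_ge0.
by rewrite -big_split /=; apply: eq_bigr => i _; rewrite scalerDl.
Qed.

Lemma cone_hullZ s a x : 0 <= a -> cone_hull s x -> cone_hull s (a *: x).
Proof.
move=> a0 [c c0 ->]; exists (fun i => a * c i); first by move=> i; rewrite mulr_ge0.
by rewrite scaler_sumr; apply: eq_bigr => i _; rewrite scalerA.
Qed.

Lemma cone_hull_sum s (I : Type) (r : seq I) (P : pred I) (f : I -> 'rV_n) :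
  (forall i, P i -> cone_hull s (f i)) -> cone_hull s (\sum_(i <- r | P i) f i).
Proof.
by move=> sf; apply: big_ind => //; [apply: cone_hull0 | apply: cone_hullD].
Qed.

Lemma cone_hull_mem s x : x \in s -> cone_hull s x.
Proof.
elim: s => // g s IH; rewrite inE => /predU1P[->|/IH sx]; apply/cone_hull_cons.
  by exists 1, 0; rewrite scale1r addr0; split=> //; apply: cone_hull0.
by exists 0, x; rewrite scale0r add0r; split.
Qed.

Lemma cone_hull_sub s s' :
  (forall g, g \in s -> cone_hull s' g) -> cone_hull s `<=` cone_hull s'.
Proof.
move=> ss' x [c c0 ->]; apply: cone_hull_sum => i _.
by apply: cone_hullZ => //; apply: ss'; rewrite mem_nth.
Qed.

Lemma pairing_cone_hull s m : (forall g, g \in s -> 0 <= pairing m g) ->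
  forall x, cone_hull s x -> 0 <= pairing m x.
Proof.
move=> ms x [c c0 ->]; rewrite pairing_sumr sumr_ge0 // => i _.
by rewrite pairingZr mulr_ge0 // ms ?mem_nth.
Qed.

(* Induction on the number of generators: when the functional found for [s] is
   negative on the new generator [g], project along [g] onto its kernel. *)
Lemma farkas s u : ~ cone_hull s u ->
  exists2 m, (forall g, g \in s -> 0 <= pairing m g) & pairing m u < 0.
Proof.
have [k] := ubnP (size s); elim: k s u => // k IH [|g s] u /= lts nsu.
  have [i ui] : exists i, u 0 i != 0.
    apply: contrapT => none; apply: nsu; have -> : u = 0; last exact: cone_hull0.
    apply/rowP => i; rewrite mxE; apply/eqP; apply: contrapT => /negP ui.
    by apply: none; exists i.
  exists (- u 0 i *: delta_mx i 0) => //.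
  rewrite pairingZl /pairing mxE (bigD1 i) //= big1 => [|j ji].
    rewrite mxE !eqxx mulr1 addr0 mulNr oppr_lt0.
    by rewrite lt_def mulf_neq0 //= -expr2 sqr_ge0.
  by rewrite mxE (negPf ji) mulr0.
have [m ms mu] : exists2 m, (forall g, g \in s -> 0 <= pairing m g) & pairing m u < 0.
  apply: IH => // su; apply: nsu; apply/cone_hull_cons.
  by exists 0, u; rewrite scale0r add0r; split.
have [mg|mg] := leP 0 (pairing m g).
  by exists m => // h; rewrite inE => /predU1P[->|/ms].
pose pr x := x - (pairing m x / pairing m g) *: g.
have [||m' m's m'u] := IH [seq pr h | h <- s] (pr u); first by rewrite size_map.
  move=> [c c0]; rewrite /pr => /(canRL (subrK _)) eu; apply: nsu.
  apply/cone_hull_cons; move: c c0 eu; rewrite size_map => c c0 eu.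
  exists (pairing m u / pairing m g - \sum_(i < size s) c i * (pairing m s`_i / pairing
    m g)).
  exists (\sum_(i < size s) c i *: s`_i); split; last 2 first.
  - by exists c.
  - rewrite [LHS]eu scalerBl scaler_suml [LHS]addrC -[RHS]addrA; congr (_ + _).
    rewrite -sumrN -big_split /=; apply: eq_bigr => i _.
    by rewrite (nth_map 0) // scalerBr scalerA addrC.
  rewrite subr_ge0 (@le_trans _ _ 0) //.
    apply: sumr_le0 => i _; rewrite mulr_ge0_le0 // mulr_ge0_le0 ?ms ?mem_nth //.
    by rewrite invr_le0 ltW.
  by rewrite mulr_le0 ?invr_le0 ?ltW.
have pm' x : pairing (m' - (pairing m' g / pairing m g) *: m) x = pairing m' (pr x).
  rewrite -scaleNr pairingDl pairingZl /pr pairingBr pairingZr; ring.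
exists (m' - (pairing m' g / pairing m g) *: m); last by rewrite pm'.
move=> h; rewrite pm' inE => /predU1P[->|hs].
  by rewrite /pr divff ?lt_eqF // scale1r subrr pairing0r.
by apply: m's; apply/mapP; exists h.
Qed.

End Farkas.

(** The subspaces are avoided one at a time, by a step from the point already found towards some [g]
    of the cone outside [W]. The line so described meets each of the subspaces at most once, so a
    small enough step leaves [W], enters no subspace avoided before and preserves the open condition
    [P]. *)
Lemma cone_avoid n (C : set 'rV[rat]_n) (Ws : seq {vspace 'rV[rat]_n}) c
    (P : 'rV[rat]_n -> Prop) :
  (forall x y, C x -> C y -> C (x + y)) ->
  (forall a x, 0 <= a -> C x -> C (a *: x)) ->
  (forall x g, C g -> P x -> eventually (fun k => P (x + tiny k *: g))) ->
  (forall W, W \in Ws -> exists2 g, C g & g \notin W) ->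
  C c -> P c ->
  exists p, [/\ C p, P p & forall W, W \in Ws -> p \notin W].
Proof.
move=> CD CZ Popen; elim: Ws => [|W Ws IH] gW Cc Pc; first by exists c.
have [|p [Cp Pp pWs]] := IH _ Cc Pc.
  by move=> W' W's; apply: gW; rewrite inE W's orbT.
have [g Cg gnW] := gW W (mem_head _ _).
have avoid (W' : {vspace 'rV[rat]_n}) : g \notin W' \/ p \notin W' ->
    eventually (fun k => p + tiny k *: g \notin W').
  move=> gp; case: (pselect (exists k, p + tiny k *: g \in W')) => [[k kW]|none].
    exists k.+1 => j ltkj; apply/negP => jW.
    have gW' : g \in W'.
      have /(memvZ (tiny j - tiny k)^-1) := memvB jW kW.
      rewrite opprD addrACA subrr add0r -scalerBl scalerA mulVf ?scale1r //.
      by rewrite subr_eq0; apply: contraTneq ltkj => /tiny_inj ->; rewrite ltnn.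
    case: gp; rewrite ?gW' // -(addrK (tiny k *: g) p) memvB // memvZ //.
  by exists 0%N => k _; apply/negP => kW; apply: none; exists k.
have ev : eventually (fun k => forall i : 'I_(size (W :: Ws)),
    p + tiny k *: g \notin nth 0%VS (W :: Ws) i).
  apply: eventually_all => i; apply: avoid.
  case: i => [[|i] /= lti]; [by left | right].
  by apply: pWs; rewrite mem_nth.
have [N /(_ N (leqnn N)) [pN PN]] := eventually_and ev (Popen p g Cg Pp).
exists (p + tiny N *: g); split=> //.
  by apply: CD => //; apply: CZ => //; rewrite ltW ?tiny_gt0.
move=> W' /(nthP 0%VS) [i lti <-]; exact: (pN (Ordinal lti)).
Qed.

(** * Simplicial complexes of cones *)

Section Families.
Variables (n : nat) (I : finType) (v : I -> 'rV[rat]_n).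
Implicit Types (S T : {set I}) (x y u : 'rV[rat]_n).

Definition scone S : set 'rV[rat]_n :=
  [set x | exists2 a : I -> rat, (forall i, 0 <= a i) & x = \sum_(i in S) a i *: v i].

Definition indep S := forall a : I -> rat,
  \sum_(i in S) a i *: v i = 0 -> forall i, i \in S -> a i = 0.

Definition sspan S : {vspace 'rV[rat]_n} := <<[seq v i | i <- enum S]>>%VS.

(** The [i]-th coordinate in the basis [S] of [sspan S], when [S] is independent and contains [i];
    off that span the functional is an arbitrary extension. *)
Definition dual S i : 'cV[rat]_n :=
  xget 0 [set m | forall j, j \in S -> pairing m (v j) = (i == j)%:R].

Lemma map_enum_tuple S :
  [seq v i | i <- enum S] = [tuple v (enum_val j) | j < #|S|].
Proof.
apply: (@eq_from_nth _ 0); first by rewrite size_map -cardE size_tuple.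
move=> i; rewrite size_map -cardE => lti.
rewrite (nth_map (enum_val (Ordinal lti))) -?cardE //.
rewrite -[RHS](tnth_nth 0 [tuple v (enum_val j) | j < #|S|] (Ordinal lti)).
by rewrite tnth_mktuple; congr v; apply: set_nth_default; rewrite -cardE.
Qed.

Lemma indep_free S : indep S <-> free [seq v i | i <- enum S].
Proof.
rewrite map_enum_tuple; split=> [iS|/freeP frS a a0 i Si].
  apply/freeP => k k0 j.
  have /iS : \sum_(i in S) k (enum_rank_in (enum_valP j) i) *: v i = 0.
    rewrite big_enum_val -[RHS]k0; apply: eq_bigr => l _.
    by rewrite enum_valK_in -tnth_nth tnth_mktuple.
  by move/(_ _ (enum_valP j)); rewrite enum_valK_in.
rewrite -(enum_rankK_in Si Si); apply: (frS (fun j => a (enum_val j))).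
rewrite -[RHS]a0 [RHS]big_enum_val; apply: eq_bigr => j _.
by rewrite -tnth_nth tnth_mktuple.
Qed.

Lemma dim_sspan S : indep S -> \dim (sspan S) = #|S|.
Proof.
by move=> /indep_free; rewrite /free => /eqP ->; rewrite size_map -cardE.
Qed.

Lemma dualP S i j : indep S -> i \in S -> j \in S ->
  pairing (dual S i) (v j) = (i == j)%:R.
Proof.
move=> iS Si Sj; rewrite /dual.
have := (indep_free S).1 iS; rewrite map_enum_tuple; set X := [tuple _ | _ < _] => frX.
have [|m mP] := @pairing_represent n (fun x => coord X (enum_rank_in Si i) x).
  by move=> a x y; rewrite linearP.
case: xgetP => [m' -> m'P|/(_ m)]; first exact: m'P.
case=> l Sl; rewrite mP.
have -> : v l = X`_(enum_rank_in Si l).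
  by rewrite -tnth_nth tnth_mktuple enum_rankK_in.
by rewrite coord_free // -(inj_eq enum_val_inj) !enum_rankK_in // eq_sym.
Qed.

Lemma sspan_sum S (a : I -> rat) : \sum_(i in S) a i *: v i \in sspan S.
Proof.
apply: memv_suml => i Si; rewrite memvZ // memv_span //.
by apply/mapP; exists i; rewrite ?mem_enum.
Qed.

Lemma mem_sspan S i : i \in S -> v i \in sspan S.
Proof. by move=> Si; rewrite memv_span //; apply/mapP; exists i; rewrite ?mem_enum. Qed.

Lemma sspanS S T : S \subset T -> (sspan S <= sspan T)%VS.
Proof.
move=> /fintype.subsetP ST; apply/span_subvP => _ /mapP[i + ->].
by rewrite mem_enum => /ST /mem_sspan.
Qed.

Lemma scone_sspan S x : scone S x -> x \in sspan S.
Proof. by move=> [a _ ->]; apply: sspan_sum. Qed.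

Lemma pairing_dual_sum S (a : I -> rat) i : indep S -> i \in S ->
  pairing (dual S i) (\sum_(j in S) a j *: v j) = a i.
Proof.
move=> iS Si; rewrite pairing_sumr (bigD1 i) //= pairingZr dualP // eqxx mulr1.
rewrite big1 ?addr0 // => j /andP[Sj ji]; rewrite pairingZr dualP //.
by rewrite eq_sym (negPf ji) mulr0.
Qed.

Lemma sspanP S x : indep S -> x \in sspan S ->
  x = \sum_(i in S) pairing (dual S i) x *: v i.
Proof.
move=> iS; rewrite /sspan map_enum_tuple => /coord_span xE.
pose a i := if [pick j | enum_val j == i] is Some j then coord [tuple v (enum_val j) |
  j < #|S|] j x else 0.
have {}xE : x = \sum_(i in S) a i *: v i.
  rewrite [LHS]xE [RHS]big_enum_val; apply: eq_bigr => j _.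
  rewrite -tnth_nth tnth_mktuple /a; case: pickP => [l /eqP/enum_val_inj -> //|].
  by move=> /(_ j); rewrite eqxx.
by rewrite [LHS]xE; apply: eq_bigr => i Si; rewrite xE pairing_dual_sum.
Qed.

Lemma pairing_sspan S m x : indep S -> x \in sspan S ->
  pairing m x = \sum_(i in S) pairing (dual S i) x * pairing m (v i).
Proof.
move=> iS /(sspanP iS) {1}->; rewrite pairing_sumr.
by apply: eq_bigr => i _; rewrite pairingZr.
Qed.

Lemma sconeP S x : indep S -> scone S x <->
  x \in sspan S /\ forall i, i \in S -> 0 <= pairing (dual S i) x.
Proof.
move=> iS; split=> [Sx|[xS x0]].
  split; [exact: scone_sspan | move=> i Si]; case: Sx => a a0 ->.
  by rewrite pairing_dual_sum.
exists (fun i => if i \in S then pairing (dual S i) x else 0).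
  by move=> i; case: ifP => [/x0|].
by rewrite [LHS](sspanP iS xS); apply: eq_bigr => i ->.
Qed.

(** The cone is closed, so it keeps [x]. Two distinct perturbed points put [y] in the span, and
    where a coordinate of [x] vanishes, the perturbed coordinate has the sign of that of [y]. *)
Lemma scone_limit S x y : indep S ->
  (forall N, exists2 k, (N <= k)%N & scone S (x + tiny k *: y)) ->
  [/\ scone S x, y \in sspan S &
      forall i, i \in S -> pairing (dual S i) x = 0 -> 0 <= pairing (dual S i) y].
Proof.
move=> iS freq.
have [k0 _ /(sconeP _ iS)[s0 _]] := freq 0%N.
have [k1 lt01 /(sconeP _ iS)[s1 _]] := freq k0.+1.
have yS : y \in sspan S.
  have /(memvZ (tiny k0 - tiny k1)^-1) := memvB s0 s1.
  rewrite opprD addrACA subrr add0r -scalerBl scalerA mulVf ?scale1r //.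
  by rewrite subr_eq0; apply: contraTneq lt01 => /tiny_inj ->; rewrite ltnn.
have xS : x \in sspan S by rewrite -(addrK (tiny k0 *: y) x) memvB // memvZ.
split=> //.
  apply/sconeP => //; split=> // i Si.
  apply: (frequently_ge0 (b := pairing (dual S i) y) freq) => k /(sconeP _ iS)[_ /(_ i Si)].
  by rewrite pairingDr pairingZr.
move=> i Si xi0; have [k _ /(sconeP _ iS)[_ /(_ i Si)]] := freq 0%N.
by rewrite pairingDr pairingZr xi0 add0r pmulr_rge0 // tiny_gt0.
Qed.

Lemma sum_extend S T (a : I -> rat) : S \subset T ->
  \sum_(i in T) (if i \in S then a i else 0) *: v i = \sum_(i in S) a i *: v i.
Proof.
move=> ST; rewrite (eq_bigr (fun i => if i \in S then a i *: v i else 0)).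
  rewrite -big_mkcondr; apply: eq_bigl => i /=.
  by rewrite andbC; case: (boolP (i \in S)) => // /(fintype.subsetP ST) ->.
by move=> i _; case: ifP; rewrite ?scale0r.
Qed.

Lemma sconeS S T x : S \subset T -> scone S x -> scone T x.
Proof.
move=> ST [a a0 ->]; exists (fun i => if i \in S then a i else 0).
  by move=> i; case: ifP.
by rewrite sum_extend.
Qed.

Lemma sconeD S x y : scone S x -> scone S y -> scone S (x + y).
Proof.
move=> [a a0 ->] [b b0 ->]; exists (fun i => a i + b i).
  by move=> i; rewrite addr_ge0.
by rewrite -big_split; apply: eq_bigr => i _; rewrite scalerDl.
Qed.

Lemma sconeZ S a x : 0 <= a -> scone S x -> scone S (a *: x).
Proof.
move=> a0 [b b0 ->]; exists (fun i => a * b i); first by move=> i; rewrite mulr_ge0.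
by rewrite scaler_sumr; apply: eq_bigr => i _; rewrite scalerA.
Qed.

Lemma scone_mem S i : i \in S -> scone S (v i).
Proof.
move=> Si; exists (fun j => (j == i)%:R); first by move=> j; rewrite ler0n.
by rewrite (bigD1 i) //= eqxx scale1r big1 ?addr0 // => j /andP[_ /negPf ->];
  rewrite scale0r.
Qed.

Lemma scone0 S : scone S 0.
Proof. by exists (fun=> 0) => //; rewrite big1 // => i _; rewrite scale0r. Qed.

Lemma indepS S T : S \subset T -> indep T -> indep S.
Proof.
move=> ST iT a a0 i Si; have := iT (fun i => if i \in S then a i else 0).
by rewrite sum_extend // => /(_ a0 i (fintype.subsetP ST _ Si)); rewrite Si.
Qed.

End Families.

(** * Simplicial complexes with convex support *)

Section Complexes.
Variables (n : nat) (I : finType) (v : I -> 'rV[rat]_n).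
Implicit Types (K : {set {set I}}) (S T : {set I}) (x y u : 'rV[rat]_n)
  (m : 'cV[rat]_n).

Definition csupport K : set 'rV[rat]_n := [set x | exists2 S, S \in K & scone v S x].

(** A set of indices stands for the cone on its vectors. Closure under addition expresses convexity,
    as the support is stable under nonnegative scaling anyway. *)
Record convex_complex K : Prop := ConvexComplex {
  complex_empty : finset.set0 \in K;
  complex_down : forall S T, T \in K -> S \subset T -> S \in K;
  complex_indep : forall S, S \in K -> indep v S;
  complex_inter : forall S T x, S \in K -> T \in K ->
    scone v S x -> scone v T x -> scone v (S :&: T)%SET x;
  complex_convex : forall x y, csupport K x -> csupport K y -> csupport K (x + y)
}.

(** Facets in the sense of simplicial complexes: cones of full dimension in the span of the support,
    not faces of codimension one. *)
Definition facet K S := (S \in K) && (#|S| == \dim (sspan v (finset.cover K))).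

Definition generic K u := u \in sspan v (finset.cover K) /\
  forall S i, facet K S -> i \in S -> pairing (dual v S i) u != 0.

(** The sum of the generators represents the relative interior of the cone of [T]; the condition is
    that [u] points from there into the support. *)
Definition visible K u T :=
  `[< exists2 e, 0 < e & csupport K (\sum_(i in T) v i + e *: u) >].

Section Complex.
Variables (K : {set {set I}}) (cK : convex_complex K).
Let V := sspan v (finset.cover K).

Lemma mem_complex S i : S \in K -> i \in S -> i \in finset.cover K.
Proof. by move=> KS Si; apply/finset.bigcupP; exists S. Qed.

Lemma csupportZ a x : 0 <= a -> csupport K x -> csupport K (a *: x).
Proof. by move=> a0 [S KS Sx]; exists S => //; apply: sconeZ. Qed.

Lemma csupport0 : csupport K 0.
Proof. by exists finset.set0; [case: cK | apply: scone0]. Qed.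

Lemma csupport_mem i : i \in finset.cover K -> csupport K (v i).
Proof. by move=> /finset.bigcupP[S KS Si]; exists S => //; apply: scone_mem. Qed.

Lemma csupport_sum (P : pred I) (a : I -> rat) : (forall i, 0 <= a i) ->
  (forall i, P i -> i \in finset.cover K) -> csupport K (\sum_(i | P i) a i *: v i).
Proof.
move=> a0 PK; apply: big_ind => [||i /PK/csupport_mem]; first exact: csupport0.
  by case: cK.
exact: csupportZ.
Qed.

Lemma csupport_span x : csupport K x -> x \in V.
Proof.
move=> [S KS /scone_sspan]; apply: subvP; apply: sspanS.
by apply/fintype.subsetP => i; apply: mem_complex.
Qed.

Lemma csupport_face S x : S \in K -> scone v S x ->
  exists2 T, T \in K & exists2 a : I -> rat, (forall i, i \in T -> 0 < a i) &
    x = \sum_(i in T) a i *: v i.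
Proof.
move=> KS [a a0 ->]; exists [set i in S | 0 < a i]%SET.
  by apply: complex_down KS _ => //; apply/fintype.subsetP => i; rewrite inE => /andP[].
exists a => [i|]; first by rewrite inE => /andP[].
rewrite (bigID (fun i => 0 < a i)) /= [X in _ + X]big1 ?addr0.
  by apply: eq_bigl => i; rewrite inE.
move=> i /andP[_]; rewrite -leNgt => ai; rewrite (_ : a i = 0) ?scale0r //.
by apply/eqP; rewrite eq_le ai a0.
Qed.

Lemma leq_card_complex S : S \in K -> (#|S| <= \dim V)%N.
Proof.
move=> KS; rewrite -(dim_sspan (complex_indep cK KS)); apply/dimvS/sspanS.
by apply/fintype.subsetP => i; apply: mem_complex.
Qed.

Lemma sspan_facet S : facet K S -> sspan v S = V.
Proof.
move=> /andP[KS /eqP dS]; apply/eqP; rewrite eqEdim sspanS; last first.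
  by apply/fintype.subsetP => i; apply: mem_complex.
by rewrite /= (dim_sspan (complex_indep cK KS)) dS.
Qed.

(** The cones that are not facets span proper subspaces of [V], each missing some generator of the
    support, so [cone_avoid] applies with the open condition that [m] be negative. *)
Lemma generic_exists c m : csupport K c -> pairing m c < 0 ->
  exists u, [/\ csupport K u, pairing m u < 0 &
    forall S, S \in K -> ~~ facet K S -> u \notin sspan v S].
Proof.
move=> Kc mc; have [||||p [Kp mp pS]] := @cone_avoid n (csupport K)
    [seq sspan v T | T <- enum [set T in K | ~~ facet K T]%SET] c
    (fun x => pairing m x < 0) _ _ _ _ Kc mc.
- by case: cK.
- exact: csupportZ.
- move=> x g _ mx; have := @eventually_pos (- pairing m x) (- pairing m g).
  rewrite oppr_gt0 => /(_ mx) [N lN]; exists N => k /lN.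
  by rewrite mulrN -opprD oppr_gt0 pairingDr pairingZr.
- move=> _ /mapP[S + ->]; rewrite mem_enum inE => /andP[KS nfS].
  apply: contrapT => none; move: nfS; rewrite /facet KS /= => /eqP; apply.
  apply/eqP; rewrite eqn_leq leq_card_complex //.
  rewrite -(dim_sspan (complex_indep cK KS)); apply: dimvS.
  apply/span_subvP => _ /mapP[i + ->]; rewrite mem_enum => Ki.
  apply: contrapT => /negP nSi; apply: none; exists (v i) => //.
  exact: csupport_mem.
exists p; split=> // S KS nfS; apply: pS; apply/mapP; exists S => //.
by rewrite mem_enum inE KS.
Qed.

(** If the coordinate of [u] at a ray [i] of a facet vanished, [u] would lie in the span of the
    remaining rays, which do not form a facet. *)
Lemma generic_csupport u : csupport K u ->
  (forall S, S \in K -> ~~ facet K S -> u \notin sspan v S) -> generic K u.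
Proof.
move=> Ku uS; split=> [|S i fS Si]; first exact: csupport_span.
have [KS cS] := andP fS; have iS := complex_indep cK KS.
have sub : S :\ i \subset S by apply: finset.subD1set.
have nf : ~~ facet K (S :\ i).
  rewrite /facet negb_and -(eqP cS) [in X in _ || X](finset.cardsD1 i S) Si.
  by rewrite neq_ltn ltnS leqnn orbT.
apply/eqP => ti0; apply: (negP (uS _ (complex_down cK KS sub) nf)).
have uV : u \in sspan v S by rewrite sspan_facet // csupport_span.
rewrite (sspanP iS uV) (bigD1 i) //= ti0 scale0r add0r.
rewrite (eq_bigl (mem (S :\ i)%SET)); first exact: sspan_sum.
by move=> j; rewrite /= !inE andbC.
Qed.

(** Perturb [x] towards a point [p] outside the span of every non-facet. One cone contains
    [x + tiny k *: p] for infinitely many [k]; in the limit it contains [x], and since its span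
    contains [p] it is a facet. *)
Lemma csupport_facet x : csupport K x -> exists2 S, facet K S & scone v S x.
Proof.
have [p Kp pS] : exists2 p, csupport K p &
    forall S, S \in K -> ~~ facet K S -> p \notin sspan v S.
  case: (pselect (exists2 c, csupport K c & c != 0)) => [[c Kc /eqP c0]|none].
    have [m mc] : exists m, pairing m c < 0.
      have [|m _ mc] := @farkas n [::] c; last by exists m.
      by move=> [a _]; rewrite big_ord0.
    by have [u [Ku _ uS]] := generic_exists Kc mc; exists u.
  exists 0; first exact: csupport0.
  move=> S KS; rewrite /facet KS /= => /eqP[]; apply/eqP.
  rewrite eqn_leq leq_card_complex // (_ : \dim V = 0%N) //.
  apply/eqP; rewrite dimv_eq0 -subv0; apply/span_subvP => _ /mapP[i + ->].
  rewrite mem_enum => /csupport_mem Ki; rewrite memv0; apply: contrapT => /negP vi.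
  by apply: none; exists (v i).
move=> Kx; have [S freq] : exists S, forall N, exists2 k, (N <= k)%N &
    (S \in K) /\ scone v S (x + tiny k *: p).
  apply: frequently_pigeonhole => k.
  have [|S KS Sx] := complex_convex cK Kx (_ : csupport K (tiny k *: p)).
    by apply: csupportZ => //; rewrite ltW ?tiny_gt0.
  by exists S.
have [_ _ [KS _]] := freq 0%N.
have [|Sx Sp _] := @scone_limit _ _ v S x p (complex_indep cK KS).
  by move=> N; have [k ? []] := freq N; exists k.
by exists S => //; apply: contrapT => /negP /(pS _ KS); rewrite Sp.
Qed.

(** The point [x] is in the relative interior of the cone of [S] and lies in the cone of [S :&: T].
    Uniqueness of coordinates in [S] then leaves no ray of [S] outside [T]. *)
Lemma scone_subset S T x (a : I -> rat) : S \in K -> T \in K ->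
  (forall i, i \in S -> 0 < a i) -> x = \sum_(i in S) a i *: v i ->
  scone v T x -> S \subset T.
Proof.
move=> KS KT a0 xE Tx; have iS := complex_indep cK KS.
have Sx : scone v S x.
  exists (fun i => if i \in S then a i else 0).
    by move=> i; case: ifP => // /a0/ltW.
  by rewrite xE; apply: eq_bigr => i ->.
have [b b0] := complex_inter cK KS KT Sx Tx.
rewrite -(sum_extend _ _ (finset.subsetIl S T)) => xb.
apply/fintype.subsetP => i Si; have := pairing_dual_sum a iS Si.
rewrite -xE xb pairing_dual_sum // finset.in_setI Si /=.
by case: ifP => // _ ai; have := a0 i Si; rewrite -ai ltxx.
Qed.

(** For generic [u], the facets whose tangent cone along [T] contains [u]: from the relative
    interior of [T] a small step cannot spoil the coordinates in [T], so only the others are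
    constrained. *)
Definition star u T := [set S | facet K S && (T \subset S) &&
  [forall (i | i \in S :\: T), 0 < pairing (dual v S i) u]]%SET.

Lemma star_point u T S : u \in V -> S \in star u T ->
  eventually (fun k => (forall i, i \in S ->
      0 < (i \in T)%:R + tiny k * pairing (dual v S i) u) /\
    \sum_(i in T) v i + tiny k *: u =
    \sum_(i in S) ((i \in T)%:R + tiny k * pairing (dual v S i) u) *: v i).
Proof.
move=> uV; rewrite inE => /andP[/andP[fS TS] /'forall_implyP pos].
have [KS _] := andP fS.
have [N lN] : eventually (fun k => forall i, i \in S ->
    0 < (i \in T)%:R + tiny k * pairing (dual v S i) u).
  apply: eventually_all => i; have [iT|niT] := boolP (i \in T).
    by have [N lN] := eventually_pos (pairing (dual v S i) u) (ltr01 : 0 < 1 :> rat);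
      exists N => k /lN.
  exists 0%N => k _ Si; rewrite add0r mulr_gt0 ?tiny_gt0 //; apply: pos.
  by rewrite inE niT.
exists N => k /lN pk; split=> //.
rewrite -(sspan_facet fS) in uV.
rewrite {1}(sspanP (complex_indep cK KS) uV) scaler_sumr.
rewrite -(eq_bigr _ (fun i _ => scale1r (v i))) -(sum_extend _ _ TS) -big_split /=.
by apply: eq_bigr => i Si; rewrite scalerA -scalerDl; case: ifP.
Qed.

(* The tangent cones at [T] of the facets around [T] tile the tangent cone of
   the support. *)
Lemma card_star u T : generic K u -> T \in K -> #|star u T| = visible K u T.
Proof.
move=> [uV tS] KT.
have facetK S : S \in star u T -> S \in K.
  by rewrite inE -andbA => /andP[/andP[]].
have uniq_star S S' : S \in star u T -> S' \in star u T -> S \subset S'.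
  move=> sS sS'.
  have [N /(_ N (leqnn N)) [[p1 e1] [p2 e2]]] :=
    eventually_and (star_point uV sS) (star_point uV sS').
  apply: (scone_subset (facetK _ sS) (facetK _ sS') p1 e1).
  exists (fun i => if i \in S' then (i \in T)%:R + tiny N * pairing (dual v S' i) u else 0).
    by move=> i; case: ifP => // /p2/ltW.
  by rewrite e2; apply: eq_bigr => i ->.
case: (finset.set_0Vmem (star u T)) => [s0|[S sS]]; last first.
  rewrite (_ : star u T = finset.set1 S); last first.
    apply/finset.setP => S'; rewrite finset.in_set1.
    apply/idP/eqP => [sS'|-> //].
    by apply/eqP; rewrite finset.eqEsubset !uniq_star.
  rewrite finset.cards1 (_ : visible K u T = true) //; apply/asboolP.
  have [N /(_ N (leqnn N)) [p e]] := star_point uV sS.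
  exists (tiny N); first exact: tiny_gt0.
  exists S; first exact: facetK.
  exists (fun i => if i \in S then (i \in T)%:R + tiny N * pairing (dual v S i) u else 0).
    by move=> i; case: ifP => // /p/ltW.
  by rewrite e; apply: eq_bigr => i ->.
rewrite s0 finset.cards0 (_ : visible K u T = false) //; apply/negbTE/asboolP.
move=> [e e0 Ke].
have Kx : csupport K (\sum_(i in T) v i).
  rewrite -(eq_bigr _ (fun i _ => scale1r (v i))); apply: csupport_sum => // i.
  exact: mem_complex.
have [N lN] := tiny_small e0.
(* By convexity all steps shorter than [e] stay in the support, and a single facet receives
   arbitrarily short ones; the shift to [maxn N k] keeps the steps below [e]. *)
have [S freq] : exists S, forall N, exists2 k, (N <= k)%N &
    facet K S /\ scone v S (\sum_(i in T) v i + tiny k *: u).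
  have [|S freq] := @frequently_pigeonhole _ (fun S k =>
      facet K S /\ scone v S (\sum_(i in T) v i + tiny (maxn N k) *: u)).
    move=> k; have [|S fS Sx] := @csupport_facet (\sum_(i in T) v i + tiny (maxn N k) *: u).
      set d := tiny _; have ld : d < e by apply: lN; rewrite leq_maxl.
      have d0 : 0 < d := tiny_gt0 _.
      rewrite (_ : _ + _ = (1 - d / e) *: (\sum_(i in T) v i) +
          (d / e) *: (\sum_(i in T) v i + e *: u)).
        apply: (complex_convex cK); apply: csupportZ => //.
          by rewrite subr_ge0 ler_pdivrMr // mul1r ltW.
        by rewrite divr_ge0 ?ltW.
      by rewrite scalerDr scalerA divfK ?gt_eqF // addrA -scalerDl subrK scale1r.
    by exists S.
  exists S => N'; have [k lk SP] := freq N'.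
  by exists (maxn N k) => //; rewrite leq_max lk orbT.
have [_ _ [fS _]] := freq 0%N; have [KS _] := andP fS.
have iS := complex_indep cK KS.
have [|Sx Su Spos] := @scone_limit _ _ v S (\sum_(i in T) v i) u iS.
  by move=> N'; have [k ? []] := freq N'; exists k.
have TS : T \subset S.
  apply: (@scone_subset _ _ _ (fun=> 1) KT KS _ _ Sx) => //.
  by apply: eq_bigr => i _; rewrite scale1r.
have : S \in star u T.
  rewrite inE fS TS /=; apply/'forall_implyP => i; rewrite inE => /andP[niT Si].
  rewrite lt_def tS //=; apply: Spos => //.
  rewrite -(eq_bigr _ (fun i _ => scale1r (v i))) -(sum_extend _ _ TS).
  by rewrite pairing_dual_sum // (negPf niT).
by rewrite s0 inE.
Qed.

End Complex.
End Complexes.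

(** * Signed indicators *)

Section FlippedIndicator.

(* The coefficient of [x ^ a] in the expansion of [1 / (1 - x)] in powers of [x]
   if [t > 0], and in powers of [1 / x] if [t < 0]. *)
Definition flip (t a : rat) : rat := (0 < t)%R%:R - (a < 0)%R%:R.

Lemma flip_neq0 t a : t != 0 -> flip t a != 0 -> 0 <= t * a.
Proof.
rewrite /flip; case: (ltgtP t 0) => // t0 _; case: (ltP a 0) => a0;
  rewrite ?subrr ?eqxx //= => _.
  by rewrite nmulr_rge0 // ltW.
by rewrite pmulr_rge0.
Qed.

Lemma prodr_bool (R : comNzRingType) (I : finType) (P b : pred I) :
  \prod_(i | P i) ((b i)%:R : R) = [forall (i | P i), b i]%:R.
Proof.
have [/'forall_implyP allb|] := boolP [forall (i | P i), b i].
  by rewrite big1 // => i /allb ->.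
rewrite negb_forall => /existsP[i]; rewrite negb_imply => /andP[Pi /negPf bi].
by rewrite (bigD1 i) //= bi mul0r.
Qed.

(** Expanding the product of differences, [T] is the set of factors that contribute [- [a_i < 0]],
    the others contributing [[0 < t_i]]. *)
Lemma prod_flip (I : finType) (S : {set I}) (t a : I -> rat) :
  \prod_(i in S) flip (t i) (a i) =
  \sum_(T : {set I} | T \subset S)
     (-1) ^+ #|T| * [forall (i | i \in T), a i < 0]%R%:R *
     [forall (i | i \in S :\: T), 0 < t i]%R%:R.
Proof.
pose P i : rat := if i \in S then - (a i < 0)%R%:R else 0.
pose Q i : rat := if i \in S then (0 < t i)%R%:R else 1.
rewrite big_mkcond (eq_bigr (fun i => P i + Q i)) /=; last first.
  by move=> i _; rewrite /P /Q /flip; case: ifP => _; [exact: addrC | rewrite add0r].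
rewrite bigA_distr [RHS]big_mkcond; apply: eq_bigr => T _.
case: ifPn => [/fintype.subsetP TS|]; last first.
  move=> /subsetPn[i Ti nSi]; rewrite (bigD1 i) //= Ti /P (negPf nSi).
  by rewrite mul0r.
rewrite (bigID (mem T)) /=; congr (_ * _).
  rewrite (eq_bigr (fun i => -1 * (a i < 0)%R%:R)); last first.
    by move=> i Ti; rewrite Ti /P TS // mulN1r.
  by rewrite big_split /= prodr_const prodr_bool.
rewrite -prodr_bool [in RHS]big_mkcond [in LHS]big_mkcond /=.
apply: eq_bigr => i _; rewrite !inE.
by case: ifP => //= /negPf ->; rewrite /Q; case: ifP.
Qed.

End FlippedIndicator.

(** * Euler characteristics of convex complexes *)

Section Euler.
Variables (n : nat) (I : finType) (v : I -> 'rV[rat]_n).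
Implicit Types (K : {set {set I}}) (S T : {set I}) (x y u : 'rV[rat]_n)
  (m : 'cV[rat]_n) (l : seq 'cV[rat]_n).

Definition nonneg_on (C : set 'rV[rat]_n) m := forall x, C x -> 0 <= pairing m x.

Definition neg_sign m T : rat :=
  (-1) ^+ #|T| * [forall (i | i \in T), pairing m (v i) < 0]%R%:R.

(** For integral data, the coefficient at [m] when the products of [1 / (1 - q^t_i)] attached to the
    facets are expanded in positive powers of [q]. *)
Definition flip_sum K m u : rat :=
  \sum_(S | facet v K S) \prod_(i in S) flip (pairing (dual v S i) u) (pairing m (v i)).

Lemma flip_sumE K m u : convex_complex v K -> generic v K u ->
  flip_sum K m u = \sum_(T in K) neg_sign m T * (visible v K u T)%:R.
Proof.
move=> cK gu; rewrite /flip_sum (eq_bigr _ (fun S _ => prod_flip S _ _)).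
rewrite (exchange_big_dep (mem K)) /=; last first.
  by move=> S T /andP[KS _]; apply: (complex_down cK KS).
apply: eq_bigr => T KT; rewrite -(card_star cK gu KT) -mulr_sumr; congr (_ * _).
rewrite -sum1_card natr_sum big_mkcond [RHS]big_mkcond; apply: eq_bigr => S _.
by rewrite inE; case: (_ && _) => //=; case: (FiniteQuant.quant0b _).
Qed.

(* A nonzero term has [t_i * m_i >= 0] for all [i], where [t] and [m_i] are the
   coordinates of [u] and the values of [m] on the rays, so that [m] is nonnegative
   at [u = \sum_i t_i v_i]. *)
Lemma flip_sum_eq0 K m u : convex_complex v K -> generic v K u ->
  pairing m u < 0 -> flip_sum K m u = 0.
Proof.
move=> cK [uV tS] mu; apply: big1 => S fS; have [KS _] := andP fS.
apply/eqP; apply: contraLR mu => /prodf_neq0 nz; rewrite -(sspan_facet cK fS) in uV.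
rewrite -leNgt (pairing_sspan _ (complex_indep cK KS) uV) sumr_ge0 // => i Si.
by apply: flip_neq0; [apply: tS | apply: nz].
Qed.

(* If [m] is negative somewhere on the support, it is negative at some generic [u]
   of the support; every cone is visible from [u], and [flip_sum] vanishes there. *)
Lemma euler K m : convex_complex v K ->
  \sum_(T in K) neg_sign m T = `[< nonneg_on (csupport v K) m >]%:R.
Proof.
move=> cK; have [m0|nm0] := boolP `[< nonneg_on (csupport v K) m >].
  have /asboolP {}m0 := m0.
  rewrite (bigD1 finset.set0) /=; last exact: (complex_empty cK).
  rewrite big1 => [|T /andP[KT /finset.set0Pn[i Ti]]].
    rewrite /neg_sign finset.cards0 mul1r addr0; congr (_%:R).
    have -> // : [forall (i | i \in finset.set0), pairing m (v i) < 0].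
    by apply/'forall_implyP => i; rewrite inE.
  rewrite /neg_sign; have /negbTE -> : ~~ [forall (i | i \in T), pairing m (v i) < 0].
    rewrite negb_forall; apply/existsP; exists i.
    by rewrite negb_imply Ti -leNgt; apply: m0; exists T => //; exact: scone_mem.
  by rewrite mulr0.
have [c Kc mc] : exists2 c, csupport v K c & pairing m c < 0.
  apply: contrapT => none; move: nm0 => /asboolP; apply=> x Kx.
  by rewrite leNgt; apply/negP => mx; apply: none; exists x.
have [u [Ku mu uS]] := generic_exists cK Kc mc.
have gu := generic_csupport cK Ku uS.
rewrite -[RHS](flip_sum_eq0 cK gu mu) (flip_sumE _ cK gu).
apply: eq_bigr => T KT.
rewrite (_ : visible _ _ _ _) ?mulr1 //; apply/asboolP; exists 1 => //.
rewrite scale1r; apply: (complex_convex cK) => //.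
rewrite -(eq_bigr _ (fun i _ => scale1r (v i))); apply: csupport_sum => // i.
exact: mem_complex.
Qed.

Definition slice K m := [set T in K | [forall (i | i \in T), pairing m (v i) == 0]]%SET.

(** At a point of the support, [m] is a sum of nonnegative contributions from the rays of a cone
    having the point in its relative interior; if the sum vanishes, [m] vanishes on each of these
    rays. *)
Lemma csupport_slice K m x : convex_complex v K -> nonneg_on (csupport v K) m ->
  csupport v (slice K m) x <-> csupport v K x /\ pairing m x = 0.
Proof.
move=> cK m0; split=> [[T + [a a0 ->]]|[[S KS Sx] mx]].
  rewrite inE => /andP[KT /'forall_implyP mT]; split; first by exists T => //; exists a.
  by rewrite pairing_sumr big1 // => i /mT/eqP; rewrite pairingZr => ->; rewrite mulr0.
have [T KT [a a0 xE]] := csupport_face cK KS Sx.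
exists T; last first.
  exists (fun i => if i \in T then a i else 0); last by rewrite xE; apply: eq_bigr => i ->.
  by move=> i; case: ifP => // /a0/ltW.
rewrite inE KT; apply/'forall_implyP => i Ti; move: mx; rewrite xE pairing_sumr.
have ge0 j : j \in T -> 0 <= pairing m (a j *: v j).
  by move=> Tj; rewrite pairingZr mulr_ge0 ?(ltW (a0 _ Tj)) //; apply: m0;
    exists T => //; exact: scone_mem.
move=> /(psumr_eq0P ge0)/(_ i Ti)/eqP; rewrite pairingZr mulf_eq0.
by rewrite gt_eqF ?a0.
Qed.

Lemma slice_complex K m : convex_complex v K -> nonneg_on (csupport v K) m ->
  convex_complex v (slice K m).
Proof.
move=> cK m0; split.
- rewrite inE (complex_empty cK) /=.
  by apply/'forall_implyP => i; rewrite inE.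
- move=> S T; rewrite !inE => /andP[KT /'forall_implyP mT] ST.
  rewrite (complex_down cK KT ST); apply/'forall_implyP => i Si.
  exact/mT/(fintype.subsetP ST).
- by move=> S; rewrite inE => /andP[KS _]; apply: (complex_indep cK).
- move=> S T x; rewrite !inE => /andP[KS _] /andP[KT _].
  exact: (complex_inter cK).
- move=> x y /(csupport_slice _ cK m0)[Kx mx] /(csupport_slice _ cK m0)[Ky my].
  apply/csupport_slice => //; split; first exact: (complex_convex cK).
  by rewrite pairingDr mx my addr0.
Qed.

(** For a functional of [l] that is nonnegative on the support, vanishing at the sum of the
    generators means that the whole cone lies in its hyperplane. *)
Definition avoid_sum K m l : rat :=
  \sum_(T in K | all (fun m' => pairing m' (\sum_(i in T) v i) != 0) l) neg_sign m T.

Lemma avoid_sum_cons K m m' l : convex_complex v K -> nonneg_on (csupport v K) m' ->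
  avoid_sum K m (m' :: l) = avoid_sum K m l - avoid_sum (slice K m') m l.
Proof.
move=> cK m'0; apply/eqP; rewrite eq_sym subr_eq; apply/eqP.
rewrite /avoid_sum [LHS](bigID (fun T => pairing m' (\sum_(i in T) v i) != 0)) /=.
congr (_ + _); first by apply: eq_bigl => T; rewrite -andbA [_ && (pairing _ _ != 0)]andbC.
apply: eq_bigl => T; rewrite inE negbK; have [KT|] := boolP (T \in K) => //=.
rewrite andbC; congr (_ && _); rewrite pairing_sumr psumr_eq0; last first.
  by move=> i Ti; apply: m'0; exists T => //; exact: scone_mem.
apply/allP/'forall_implyP => [h i Ti|h i _]; last by apply/implyP/h.
by have /implyP/(_ Ti) := h i (mem_index_enum i).
Qed.

(** For an invisible [T] with generator sum [x], the vector [u] is outside the cone generated by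
    [- x] and the support. The functional given by Farkas' lemma is both nonnegative and nonpositive
    at [x]. *)
Lemma invisible_hyperplanes K u : convex_complex v K -> exists l,
  (forall m, m \in l -> nonneg_on (csupport v K) m /\ pairing m u < 0) /\
  forall T, T \in K -> ~~ visible v K u T ->
    has (fun m => pairing m (\sum_(i in T) v i) == 0) l.
Proof.
move=> cK.
have supp T : exists m, (T \in K) && ~~ visible v K u T ->
    [/\ nonneg_on (csupport v K) m, pairing m u < 0 &
        pairing m (\sum_(i in T) v i) = 0].
  case: (boolP (_ && _)) => [/andP[KT /asboolP nvT]|_]; last by exists 0.
  have KxT : csupport v K (\sum_(i in T) v i).
    rewrite -(eq_bigr _ (fun i _ => scale1r (v i))); apply: csupport_sum => // i.
    exact: mem_complex.
  have [|m mK mu] := @farkas n (- (\sum_(i in T) v i) :: [seq v i | i <- enum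
    (finset.cover K)]) u.
    move=> /cone_hull_cons[a [y [a0 [c c0 yE] uE]]]; apply: nvT.
    have Ky : csupport v K y.
      rewrite yE; apply: big_ind => [||i _];
        [exact: (csupport0 cK) | exact: (complex_convex cK) |].
      apply: csupportZ => //; have := mem_nth 0 (ltn_ord i).
      by case/mapP => j + ->; rewrite mem_enum; apply: csupport_mem.
    (* From [u = - a x + y] with [y] in the support, [(a + 1) x + u = x + y]; the added 1 covers the
       case [a = 0]. *)
    exists (a + 1)^-1; first by rewrite invr_gt0 ltr_wpDl.
    rewrite (_ : _ + _ = (a + 1)^-1 *: (\sum_(i in T) v i + y)).
      apply: csupportZ; first by rewrite invr_ge0 addr_ge0.
      exact: (complex_convex cK).
    have a1 : a + 1 != 0 by rewrite gt_eqF // ltr_wpDl.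
    apply: (scalerI a1); rewrite scalerDr !scalerA mulfV // !scale1r uE scalerN.
    by rewrite addrA scalerDl scale1r [X in X - _]addrC addrK.
  exists m; have m0 : nonneg_on (csupport v K) m.
    move=> _ [S KS [a a0 ->]]; rewrite pairing_sumr sumr_ge0 // => i Si.
    rewrite pairingZr mulr_ge0 // mK // inE; apply/orP; right.
    by apply/mapP; exists i; rewrite ?mem_enum //; apply: mem_complex Si.
  split=> //; apply/eqP; rewrite eq_le m0 // andbT -oppr_ge0 -pairingNr.
  by rewrite mK // mem_head.
have [h hP] := choice supp.
exists [seq h T | T <- enum K & ~~ visible v K u T]; split.
  move=> m /mapP[T + ->]; rewrite mem_filter mem_enum andbC => /hP[].
  by [].
move=> T KT nvT; apply/hasP; exists (h T).
  by apply/mapP; exists T; rewrite // mem_filter nvT mem_enum.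
by have [|_ _ ->] := hP T; rewrite ?KT.
Qed.

(** A functional of [l] vanishing at the generator sum of a visible [T] would be negative after a
    step along [u], against its nonnegativity on the support. *)
Lemma visible_avoid K u l T : convex_complex v K -> T \in K ->
  (forall m, m \in l -> nonneg_on (csupport v K) m /\ pairing m u < 0) ->
  (~~ visible v K u T -> has (fun m => pairing m (\sum_(i in T) v i) == 0) l) ->
  visible v K u T = all (fun m => pairing m (\sum_(i in T) v i) != 0) l.
Proof.
move=> cK KT lP; have [/asboolP[e e0 Ke] _|_ /(_ isT)] := boolP (visible v K u T).
  apply/esym/allP => m /lP[m0 mu]; apply/eqP => mx.
  have := m0 _ Ke; rewrite pairingDr mx add0r pairingZr pmulr_rge0 //.
  by rewrite leNgt mu.
move=> hs; apply/esym/negbTE; rewrite -has_predC; move: hs.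
by apply: sub_has => m /=; rewrite negbK.
Qed.

End Euler.

Section Invariance.
Variables (n : nat) (I1 I2 : finType) (v1 : I1 -> 'rV[rat]_n) (v2 : I2 -> 'rV[rat]_n).

(** Inclusion-exclusion on [l] reduces both sides to sums of [neg_sign] over complexes, which by
    [euler] see the support only; slices by the same functional keep equal supports. *)
Lemma avoid_sum_invariant (K1 : {set {set I1}}) (K2 : {set {set I2}}) m l :
  convex_complex v1 K1 -> convex_complex v2 K2 ->
  csupport v1 K1 = csupport v2 K2 ->
  (forall m', m' \in l -> nonneg_on (csupport v1 K1) m') ->
  avoid_sum v1 K1 m l = avoid_sum v2 K2 m l.
Proof.
elim: l K1 K2 => [|m' l IH] K1 K2 cK1 cK2 eK l0.
  have noavoid (J : finType) (w : J -> 'rV[rat]_n) K :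
      avoid_sum w K m [::] = \sum_(T in K) neg_sign w m T.
    by apply: eq_bigl => T; rewrite andbT.
  by rewrite !noavoid !euler // eK.
have m'0 : nonneg_on (csupport v1 K1) m' by apply: l0; rewrite mem_head.
have l0' m'' : m'' \in l -> nonneg_on (csupport v1 K1) m''.
  by move=> lm; apply: l0; rewrite inE lm orbT.
have m'0' : nonneg_on (csupport v2 K2) m' by rewrite -eK.
rewrite !avoid_sum_cons // (IH _ _ cK1 cK2) //; congr (_ - _).
apply: IH; [exact: slice_complex | exact: slice_complex | |].
  apply/seteqP; split=> x /csupport_slice[] // Kx mx; apply/csupport_slice => //.
    by rewrite -eK.
  by rewrite eK.
by move=> m'' /l0' m''0 x /csupport_slice[] // Kx _; apply: m''0.
Qed.

(** The hyperplanes of the two complexes are used together. Those coming from the other complex do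
    no harm: by [visible_avoid] they contain no visible cone. *)
Lemma flip_sum_invariant (K1 : {set {set I1}}) (K2 : {set {set I2}}) m u :
  convex_complex v1 K1 -> convex_complex v2 K2 ->
  csupport v1 K1 = csupport v2 K2 -> generic v1 K1 u -> generic v2 K2 u ->
  flip_sum v1 K1 m u = flip_sum v2 K2 m u.
Proof.
move=> cK1 cK2 eK g1 g2.
have [l1 [lP1 vis1]] := invisible_hyperplanes u cK1.
have [l2 [lP2 vis2]] := invisible_hyperplanes u cK2.
have lP m' : m' \in l1 ++ l2 -> nonneg_on (csupport v1 K1) m' /\ pairing m' u < 0.
  by rewrite mem_cat => /orP[/lP1|/lP2]; rewrite ?eK.
have toavoid (J : finType) (w : J -> 'rV[rat]_n) K : convex_complex w K ->
    generic w K u -> csupport v1 K1 = csupport w K ->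
    (forall T, T \in K -> ~~ visible w K u T ->
      has (fun m => pairing m (\sum_(i in T) w i) == 0) (l1 ++ l2)) ->
    flip_sum w K m u = avoid_sum w K m (l1 ++ l2).
  move=> cK gK e vis; rewrite flip_sumE // /avoid_sum big_mkcondr.
  apply: eq_bigr => T KT; rewrite (visible_avoid cK KT (l := l1 ++ l2)) -?e //.
    by case: ifP; rewrite ?mulr1 ?mulr0.
  exact: vis.
rewrite !toavoid //.
- by apply: avoid_sum_invariant => // m' /lP[].
- by move=> T KT nv; rewrite has_cat (vis2 T) ?orbT.
- by move=> T KT nv; rewrite has_cat (vis1 T).
Qed.

End Invariance.

(** * Todd series *)

Section Truncation.
Implicit Types (p q : {poly rat}) (t : rat) (N : nat).

(** Congruence modulo ['X^N]: polynomials serve as truncated power series. *)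
Definition eqX N p q := forall j, (j < N)%N -> p`_j = q`_j.

Lemma eqX_refl N p : eqX N p p. Proof. by []. Qed.

Lemma eqX_sym N p q : eqX N p q -> eqX N q p.
Proof. by move=> pq j lj; rewrite pq. Qed.

Lemma eqX_trans N p q r : eqX N p q -> eqX N q r -> eqX N p r.
Proof. by move=> pq qr j lj; rewrite pq // qr. Qed.

Lemma eqXB N p p' q q' : eqX N p p' -> eqX N q q' -> eqX N (p - q) (p' - q').
Proof. by move=> pp' qq' j lj; rewrite !coefB pp' // qq'. Qed.

Lemma eqXM N p p' q q' : eqX N p p' -> eqX N q q' -> eqX N (p * q) (p' * q').
Proof.
move=> pp' qq' j lj; rewrite !coefM; apply: eq_bigr => -[i /= li] _.
by rewrite pp' ?qq' //; apply: leq_ltn_trans lj; rewrite ?leq_subr -1?ltnS.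
Qed.

Lemma eqXZ N a p q : eqX N p q -> eqX N (a *: p) (a *: q).
Proof. by move=> pq j lj; rewrite !coefZ pq. Qed.

Lemma eqX_sum N (I : Type) (r : seq I) (P : pred I) (f g : I -> {poly rat}) :
  (forall i, P i -> eqX N (f i) (g i)) ->
  eqX N (\sum_(i <- r | P i) f i) (\sum_(i <- r | P i) g i).
Proof. by move=> fg j lj; rewrite !coef_sum; apply: eq_bigr => i /fg ->. Qed.

Lemma eqX_prod N (I : Type) (r : seq I) (P : pred I) (f g : I -> {poly rat}) :
  (forall i, P i -> eqX N (f i) (g i)) ->
  eqX N (\prod_(i <- r | P i) f i) (\prod_(i <- r | P i) g i).
Proof. by move=> fg; apply: (big_ind2 (eqX N)) => //; apply: eqXM. Qed.

Lemma eqX_Xn N p k : (N <= k)%N -> eqX N (p * 'X^k) 0.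
Proof. by move=> lk j lj; rewrite coefMXn coef0 (leq_trans lj lk). Qed.

Definition exp_poly N t : {poly rat} := \poly_(j < N) (t ^+ j / j`!%:R).

Definition todd_poly N t : {poly rat} := \poly_(j < N) (todd_coef j * t ^+ j).

Lemma exp_polyD N s t : eqX N (exp_poly N s * exp_poly N t) (exp_poly N (s + t)).
Proof.
move=> j lj; rewrite coefM coef_poly lj [s + t]addrC exprDn mulr_suml.
apply: eq_bigr => -[i /= li] _; rewrite ltnS in li.
rewrite !coef_poly (leq_ltn_trans li lj) (leq_ltn_trans (leq_subr _ _) lj).
have f0 l : l`!%:R != 0 :> rat by rewrite pnatr_eq0 -lt0n fact_gt0.
have := bin_fact li => /(congr1 (fun k => k%:R : rat)); rewrite !natrM => <-.
have b0 : 'C(j, i)%:R != 0 :> rat by rewrite pnatr_eq0 -lt0n bin_gt0.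
rewrite -mulr_natr; field.
by rewrite !f0 b0.
Qed.

Lemma exp_polyX N k : eqX N (exp_poly N (-1) ^+ k) (exp_poly N (- k%:R)).
Proof.
elim: k => [|k IH].
  by move=> j lj; rewrite expr0 oppr0 coef_poly lj coef1; case: j {lj} => // j;
    rewrite expr0n mul0r.
rewrite exprS; apply: eqX_trans (eqXM (@eqX_refl _ _) IH) _.
by rewrite (_ : - k.+1%:R = - 1 - k%:R) ?mulrS ?opprD //; apply: exp_polyD.
Qed.

Lemma todd_polyP N t : eqX N ((1 - exp_poly N (- t)) * todd_poly N t) (t *: 'X).
Proof.
(* A truncation of [(1 - exp (- t x)) / (t x)]; [todd_coefP] says that the Todd series is its
   inverse. *)
pose H : {poly rat} := \poly_(j < N) ((- t) ^+ j / j.+1`!%:R).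
have Hexp : eqX N (1 - exp_poly N (- t)) (t *: 'X * H).
  move=> j lj; rewrite coefB coef1 coef_poly lj -scalerAl coefZ [_ * H]mulrC coefMX.
  case: j lj => [|j] lj; first by rewrite expr0 fact0 divr1 subrr mulr0.
  by rewrite /= coef_poly ltnW // exprS sub0r; ring.
have Htodd : eqX N (H * todd_poly N t) 1.
  move=> j lj; rewrite mulrC coefM coef1.
  have -> : (j == 0%N)%:R = t ^+ j * (j == 0%N)%:R by case: j {lj} => [|j];
    rewrite ?mulr0 ?mulr1.
  rewrite -todd_coefP mulr_sumr.
  apply: eq_bigr => -[i /= li] _; rewrite ltnS in li.
  rewrite !coef_poly (leq_ltn_trans li lj) (leq_ltn_trans (leq_subr _ _) lj).
  have -> : t ^+ j = t ^+ i * t ^+ (j - i) by rewrite -exprD subnKC.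
  by rewrite [(- t) ^+ _]exprNn; ring.
apply: eqX_trans (eqXM Hexp (@eqX_refl _ _)) _; rewrite -mulrA.
by rewrite -[t *: 'X]mulr1 -mulrA mul1r; apply: eqXM.
Qed.

(** Putting [x_i = t_i 'X] turns total degree into the exponent of ['X]; truncating above degree [k]
    is harmless. *)
Lemma td_coef N k (t : 'I_k -> rat) : (k < N)%N ->
  td t = (\prod_i todd_poly N (t i))`_k.
Proof.
move=> ltkN.
have -> : (\prod_i todd_poly N (t i))`_k = (\prod_i todd_poly k.+1 (t i))`_k.
  apply: (@eqX_prod k.+1) => // i _ j lj.
  by rewrite !coef_poly lj (leq_trans lj ltkN).
rewrite (eq_bigr (fun i => \sum_(j < k.+1) (todd_coef j * t i ^+ j) *: 'X^j)); last first.
  by move=> i _; rewrite /todd_poly poly_def.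
rewrite bigA_distr_bigA coef_sum /td big_mkcond; apply: eq_bigr => f _ /=.
rewrite scaler_prod -expr_sum coefZ coefXn eq_sym.
by case: eqP; rewrite ?mulr1 ?mulr0.
Qed.

End Truncation.

Section ToddSums.
Variables (J : finType) (k : nat) (eps : J -> rat) (t : J -> 'I_k -> int).
Implicit Types (z : int) (N : nat).

(* [head_poly z / cyc_poly z] is [1 / (1 - 'X ^ z)]. *)
Definition cyc_poly z : {poly rat} := 1 - 'X^`|z|%N.
Definition head_poly z : {poly rat} := if 0 < z then 1 else - 'X^`|z|%N.

Let q N := exp_poly N (-1).

Lemma comp_cyc_poly N z : eqX N (cyc_poly z \Po q N) (1 - exp_poly N (- `|z|%N%:R)).
Proof.
rewrite /cyc_poly comp_polyB comp_polyC comp_Xn_poly.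
by apply: eqXB; [|exact: exp_polyX].
Qed.

Lemma comp_cyc_todd N z :
  eqX N ((cyc_poly z \Po q N) * todd_poly N `|z|%N%:R) (`|z|%N%:R *: 'X).
Proof.
apply: eqX_trans (eqXM (@comp_cyc_poly _ _) (@eqX_refl _ _)) _; exact: todd_polyP.
Qed.

Lemma comp_head_todd N z : z != 0 ->
  eqX N ((cyc_poly z \Po q N) * todd_poly N z%:~R)
        ((head_poly z \Po q N) * (z%:~R *: 'X)).
Proof.
case: z => m z0.
  rewrite /head_poly lt_def z0 /= comp_polyC mul1r; exact: comp_cyc_todd.
rewrite /head_poly /= raddfN /= comp_Xn_poly.
have -> : (Negz m)%:~R = - m.+1%:R :> rat by rewrite NegzE mulrNz.
apply: eqX_trans (eqXM (@comp_cyc_poly _ _) (@eqX_refl _ _)) _.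
set e := exp_poly N (- _).
have e1 : eqX N (e * exp_poly N m.+1%:R) 1.
  apply: eqX_trans (@exp_polyD _ _ _) _; rewrite addNr => j lj.
  by rewrite coef_poly lj coef1; case: j {lj} => // j; rewrite expr0n mul0r.
(* Writing [1 - e = - e (1 - e^-1)] passes from the exponent [|z|] to [z]; the factor [- e] is what
   [head_poly] becomes. *)
have e2 : eqX N (1 - e) (- e * (1 - exp_poly N m.+1%:R)).
  rewrite mulrBr mulr1 mulNr opprK [- e + _]addrC; apply: eqXB; [exact: eqX_sym|by []].
apply: eqX_trans (eqXM e2 (@eqX_refl _ _)) _; rewrite -mulrA.
apply: eqXM; first by rewrite -[- e]sub0r -[- _ ^+ _]sub0r; apply: eqXB => //;
  apply/eqX_sym/exp_polyX.
by have := @todd_polyP N (- m.+1%:R); rewrite opprK.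
Qed.

(* Substitute ['X := exp (- z)]: then [cyc_poly] has a simple zero at [z = 0], and
   [head_poly z / cyc_poly z] becomes a Todd series divided by its variable. *)
Lemma td_sum_eq0 : (forall j i, t j i != 0) ->
  \sum_j eps j *: (\prod_i head_poly (t j i) *
                   \prod_(l | l != j) \prod_i cyc_poly (t l i)) = 0 ->
  \sum_j eps j * (td (fun i => (t j i)%:~R) / \prod_i (t j i)%:~R) = 0.
Proof.
(* The product of all denominators vanishes to order [#|J| * k] at 0 and the coefficient of degree
   [k] is wanted, which fixes the precision. *)
move=> t0 eq0; pose N := (#|J| * k + k).+1.
pose cyc l := \prod_i cyc_poly (t l i) \Po q N.
pose todd l := \prod_i todd_poly N (t l i)%:~R.
pose S := \sum_j (eps j / \prod_i (t j i)%:~R) *: todd j.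
pose C : rat := \prod_(j : J) \prod_(i < k) `|t j i|%N%:R.
have p0 j : \prod_i (t j i)%:~R != 0 :> rat.
  by apply/prodf_neq0 => i _; rewrite intr_eq0.
have cyc_todd l : eqX N (cyc l * todd l)
    ((\prod_i head_poly (t l i) \Po q N) * ((\prod_i (t l i)%:~R) *: 'X^k)).
  rewrite /cyc /todd !rmorph_prod /= -!big_split /=.
  have -> : (\prod_i (t l i)%:~R) *: 'X^k = \prod_(i < k) ((t l i)%:~R *: 'X) :> {poly rat}.
    by rewrite scaler_prod prodr_const card_ord.
  rewrite -big_split /=; apply: eqX_prod => i _; exact: comp_head_todd.
have S0 : eqX N ((\prod_l cyc l) * S) 0.
  have Z : \sum_j eps j *: ((\prod_i head_poly (t j i) \Po q N) *
      \prod_(l | l != j) cyc l) = 0.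
    have := congr1 (comp_poly (q N)) eq0; rewrite comp_poly0 raddf_sum /= => e0.
    rewrite -[RHS]e0; apply: eq_bigr => j _; rewrite comp_polyZ rmorphM /=.
    by congr (_ *: (_ * _)); rewrite rmorph_prod.
  have -> : 0 = (\sum_j eps j *: ((\prod_i head_poly (t j i) \Po q N) *
      \prod_(l | l != j) cyc l)) * 'X^k by rewrite Z mul0r.
  rewrite /S mulr_sumr mulr_suml; apply: eqX_sum => j _.
  have -> : (\prod_l cyc l) * ((eps j / \prod_i (t j i)%:~R) *: todd j) =
      (eps j / \prod_i (t j i)%:~R) *: (cyc j * todd j * \prod_(l | l != j) cyc l).
    by rewrite (bigD1 j) //= -scalerAr mulrAC.
  have -> : eps j *: ((\prod_i head_poly (t j i) \Po q N) * \prod_(l | l != j) cyc l) *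
    'X^k =
    (eps j / \prod_i (t j i)%:~R) *: ((\prod_i head_poly (t j i) \Po q N) *
       ((\prod_i (t j i)%:~R) *: 'X^k) * \prod_(l | l != j) cyc l).
    by rewrite -[in RHS]scalerAr -[in RHS]scalerAl scalerA divfK // -scalerAl mulrAC.
  by apply/eqXZ/eqXM.
(* Multiplied by the Todd series of [|t|], each denominator becomes [|t| 'X]. This replaces division
   by the denominators, leaving the nonzero constant [C] and a power of ['X]. *)
have CS0 : eqX N (S * (C *: 'X^(#|J| * k))) 0.
  have -> : C *: 'X^(#|J| * k) = \prod_l \prod_i (`|t l i|%N%:R *: 'X) :> {poly rat}.
    rewrite (eq_bigr (fun l => (\prod_(i < k) `|t l i|%N%:R) *: 'X^k)).
      by rewrite scaler_prod prodr_const -exprM mulnC.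
    by move=> l _; rewrite scaler_prod prodr_const card_ord.
  have : eqX N (S * \prod_l \prod_i ((cyc_poly (t l i) \Po q N) * todd_poly N `|t l
    i|%N%:R)) 0.
    rewrite (eq_bigr (fun l => cyc l * \prod_i todd_poly N `|t l i|%N%:R)); last first.
      by move=> l _; rewrite big_split /= /cyc rmorph_prod.
    rewrite big_split /= mulrA [S * _]mulrC.
    by rewrite -(mul0r (\prod_l \prod_i todd_poly N `|t l i|%N%:R)); apply: eqXM.
  apply: eqX_trans; apply: eqXM => //; apply/eqX_sym/eqX_prod => l _.
  apply: eqX_prod => i _; exact: comp_cyc_todd.
have := CS0 (#|J| * k + k)%N (ltnSn _).
rewrite -scalerAr coefZ coefMXn coef0 ltnNge leq_addr /= addKn => /eqP.
have /negPf C0 : C != 0.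
  by apply/prodf_neq0 => j _; apply/prodf_neq0 => i _; rewrite pnatr_eq0 absz_eq0.
rewrite mulf_eq0 C0 /= coef_sum => /eqP Sk; rewrite -[RHS]Sk; apply: eq_bigr => j _.
rewrite (td_coef _ (_ : (k < N)%N)) ?ltnS ?leq_addl //.
by rewrite coefZ mulrA [in LHS]mulrAC.
Qed.

End ToddSums.

Lemma big_uniq_subset (T : eqType) (s1 s2 : seq T) (f : T -> rat) :
  uniq s1 -> uniq s2 -> {subset s1 <= s2} ->
  (forall x, x \in s2 -> x \notin s1 -> f x = 0) ->
  \sum_(x <- s1) f x = \sum_(x <- s2) f x.
Proof.
move=> u1 u2 s12 f0; rewrite [RHS](bigID (mem s1)) /= [X in _ + X]big_seq_cond.
rewrite [X in _ + X]big1 ?addr0 => [|x /andP[]]; last exact: f0.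
rewrite -[RHS]big_filter; apply: perm_big; apply: uniq_perm => //.
  exact: filter_uniq.
by move=> x; rewrite mem_filter; apply/idP/andP => [x1|[]//]; split=> //; apply: s12.
Qed.

(** * Expansions in positive powers *)

Section SignedExpansion.
Implicit Types (z a : int) (N : nat).

(* The exponents of [x ^ z] in the expansion of [1 / (1 - x ^ z)] in positive
   powers of [x]. *)
Definition orient z (j : nat) : int := if 0 < z then Posz j else Negz j.

(** For [z < 0] the expansion is [1 / (1 - x^z) = - \sum_(j >= 1) x^(- z j)], whence the sign;
    [Negz] supplies the start at [j = 1]. *)
Definition series_poly N z : {poly rat} :=
  (if 0 < z then 1 else -1) *: \sum_(j < N.+1) 'X^(absz (z * orient z j)%R).

Lemma orient_inj z : injective (orient z).
Proof. by move=> i j; rewrite /orient; case: ifP => _ []. Qed.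

Lemma orient_ge0 z j : 0 <= z * orient z j.
Proof.
rewrite /orient; case: ltrP => z0; first by rewrite mulr_ge0 // ltW.
by rewrite mulr_le0.
Qed.

Lemma flip_orient z j : z != 0 ->
  flip z%:~R (orient z j)%:~R = if 0 < z then 1 else -1.
Proof.
rewrite /flip /orient !ltr0z; case: ltrgt0P => //= z0 _.
  by rewrite ltrz0 subr0.
by rewrite ltrz0 sub0r.
Qed.

Lemma orientP z a : z != 0 -> flip z%:~R a%:~R != 0 -> exists j, a = orient z j.
Proof.
rewrite /flip /orient ltr0z ltrz0; case: ltrgt0P => //= z0 _; case: a => j.
- by exists j.
- by rewrite subrr eqxx.
- by rewrite subrr eqxx.
- by exists j.
Qed.

Lemma series_polyP N z : z != 0 ->
  eqX N.+1 (cyc_poly z * series_poly N z) (head_poly z).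
Proof.
move=> z0; have zpos : (0 < `|z|)%N by rewrite absz_gt0.
have -> : series_poly N z = head_poly z * \sum_(j < N.+1) 'X^`|z| ^+ j.
  rewrite /series_poly /head_poly scaler_sumr mulr_sumr; apply: eq_bigr => j _.
  rewrite abszM /orient; case: ltrP => _.
    by rewrite scale1r mul1r exprM.
  by rewrite scaleN1r mulNr /= mulnS exprD exprM.
rewrite mulrCA /cyc_poly -opprB mulNr -subrX1 opprB mulrBr mulr1.
rewrite -[X in eqX _ _ X]subr0; apply: eqXB => //.
by rewrite -exprM; apply: eqX_Xn; rewrite leq_pmull.
Qed.

End SignedExpansion.

(** * Cancellation over lattice points *)

Section LatticeBases.
Variables (J : finType) (k : nat) (eps : J -> rat) (t : J -> 'I_k -> int).
(** A row [b] is a point of the dual lattice, given by its values on a fixed basis; [b *m A j] lists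
    its values on the [j]-th basis, and [c] and [t j] are the coordinates of one vector [u] in the
    fixed and the [j]-th basis. *)
Variables (A B : J -> 'M[int]_k) (c : 'I_k -> int).
Hypothesis t0 : forall j i, t j i != 0.
Hypothesis AB : forall j, A j *m B j = 1%:M.
Hypothesis BA : forall j, B j *m A j = 1%:M.
Hypothesis tA : forall j (b : 'rV_k), \sum_i t j i * (b *m A j) 0 i = \sum_i c i * b 0 i.
Hypothesis flip0 : forall b : 'rV_k,
  \sum_j eps j * \prod_i flip (t j i)%:~R ((b *m A j) 0 i)%:~R = 0.

Let point N j (f : {ffun 'I_k -> 'I_N.+1}) : 'rV[int]_k :=
  (\row_i orient (t j i) (f i)) *m B j.

Let points N j := [seq point j f | f : {ffun 'I_k -> 'I_N.+1}].

Let term M j (b : 'rV[int]_k) : rat :=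
  if \sum_i c i * b 0 i == Posz M then \prod_i flip (t j i)%:~R ((b *m A j) 0 i)%:~R
  else 0.

Lemma pointA N j (f : {ffun 'I_k -> 'I_N.+1}) :
  point j f *m A j = \row_i orient (t j i) (f i).
Proof. by rewrite /point -mulmxA BA mulmx1. Qed.

(** A choice of one term in every factor prescribes the values on the [j]-th basis, hence one
    lattice point; the exponent is its value at [u] because all the summands are nonnegative. *)
Lemma coef_prod_series N M j :
  (\prod_i series_poly N (t j i))`_M = \sum_(b <- points N j) term M j b.
Proof.
rewrite /points big_map big_enum /=.
rewrite /series_poly scaler_prod coefZ bigA_distr_bigA coef_sum mulr_sumr.
apply: eq_bigr => f _; rewrite -expr_sum coefXn /term -(tA j) pointA.
rewrite (_ : _ == Posz M = (M == \sum_i absz (t j i * orient (t j i) (f i))%R)%N).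
  case: ifP => _; last by rewrite mulr0.
  by rewrite mulr1; apply: eq_bigr => i _; rewrite mxE flip_orient.
rewrite eq_sym -eqz_nat; congr (_ == _).
rewrite (big_morph Posz PoszD (erefl _)); apply: eq_bigr => i _.
by rewrite mxE gez0_abs // orient_ge0.
Qed.

Lemma uniq_points N j : uniq (points N j).
Proof.
rewrite map_inj_uniq ?enum_uniq // => f g /(congr1 (mulmx^~ (A j))).
rewrite !pointA => /rowP fg; apply/ffunP => i; apply: val_inj.
by have := fg i; rewrite !mxE => /orient_inj.
Qed.

(** If the flips do not vanish, the value [M] at [u] is a sum of nonnegative terms with nonzero
    integers [t], so each term index is at most [M] and the truncation misses no point. *)
Lemma term_points N M j b : (M <= N)%N -> b \notin points N j -> term M j b = 0.
Proof.
move=> lMN; apply: contraNeq; rewrite /term.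
have [cb|_] := eqVneq (\sum_i c i * b 0 i) (Posz M); last by rewrite eqxx.
move=> /prodf_neq0 nz.
have /choice[g gP] : forall i, exists l, (b *m A j) 0 i = orient (t j i) l.
  by move=> i; apply: (orientP (t0 j i)); exact: nz.
have lt_g i : (g i < N.+1)%N.
  rewrite ltnS; apply: leq_trans lMN; rewrite -lez_nat -cb -(tA j) (bigD1 i) //= gP.
  apply: (@le_trans _ _ (t j i * orient (t j i) (g i))).
    have := t0 j i; rewrite /orient; case: ltrgt0P => // ti _.
      by rewrite ler_peMl // -gtz0_ge1.
    rewrite NegzE mulrN -mulNr; apply: (@le_trans _ _ (g i).+1%:Z).
      by rewrite lez_nat.
    by rewrite ler_peMl // -gtz0_ge1 oppr_gt0.
  rewrite lerDl sumr_ge0 // => l _; rewrite gP; exact: orient_ge0.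
apply/mapP; exists [ffun i => Ordinal (lt_g i)]; first by rewrite mem_enum.
rewrite /point -[LHS]mulmx1 -(AB j) mulmxA; congr (_ *m _).
by apply/rowP => i; rewrite !mxE ffunE /= -gP mxE.
Qed.

Lemma td_sum_of_flips :
  \sum_j eps j * (td (fun i => (t j i)%:~R) / \prod_i (t j i)%:~R) = 0.
Proof.
have series0 N : eqX N.+1 (\sum_j eps j *: \prod_i series_poly N (t j i)) 0.
  move=> M; rewrite ltnS => lMN; rewrite coef_sum coef0.
  pose all_points := undup (flatten [seq points N j | j : J]).
  rewrite (eq_bigr (fun j => \sum_(b <- all_points) eps j * term M j b)) => [|j _].
    rewrite exchange_big big1 //= => b _; rewrite /term; case: eqP => _.
      exact: flip0.
    by apply: big1 => j _; rewrite mulr0.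
  rewrite coefZ coef_prod_series -mulr_sumr; congr (_ * _).
  apply: big_uniq_subset; rewrite ?undup_uniq ?uniq_points //.
    by move=> b bj; rewrite mem_undup; apply/flatten_mapP; exists j; rewrite ?mem_enum.
  by move=> b _; apply: term_points.
(* The polynomial identity is checked one coefficient at a time, with series truncated just beyond
   it and multiplied by the common denominator [D]. *)
apply: td_sum_eq0 => //; apply/polyP => N; rewrite coef0.
pose D := \prod_j \prod_i cyc_poly (t j i).
suff /(_ N (ltnSn N)) -> : eqX N.+1 (\sum_j eps j *: (\prod_i head_poly (t j i) *
    \prod_(l | l != j) \prod_i cyc_poly (t l i)))
    (D * \sum_j eps j *: \prod_i series_poly N (t j i)).
  by rewrite (eqXM (@eqX_refl _ D) (series0 N)) ?mulr0 ?coef0.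
rewrite mulr_sumr; apply: eqX_sum => j _; rewrite -scalerAr; apply: eqXZ.
rewrite /D [X in eqX _ _ (X * _)](bigD1 j) //= mulrAC -big_split /=; apply: eqXM => //.
by apply/eqX_prod => i _; apply/eqX_sym/series_polyP.
Qed.

End LatticeBases.

Lemma tdZ k (a : rat) (t : 'I_k -> rat) : td (fun i => a * t i) = a ^+ k * td t.
Proof.
rewrite /td mulr_sumr; apply: eq_bigr => f /eqP fk.
rewrite -[X in a ^+ X]fk -prodrXr -big_split /=.
by apply: eq_bigr => i _; rewrite exprMn mulrCA.
Qed.

Lemma eq_td k (t t' : 'I_k -> rat) : t =1 t' -> td t = td t'.
Proof.
by move=> tt'; apply: eq_bigr => f _; apply: eq_bigr => i _; rewrite tt'.
Qed.

Definition todd_ratio k (t : 'I_k -> rat) : rat := td t / \prod_i t i.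

(** Homogeneity of degree zero: only the line spanned by [t] matters. *)
Lemma todd_ratioZ k (a : rat) (t : 'I_k -> rat) : a != 0 ->
  todd_ratio (fun i => a * t i) = todd_ratio t.
Proof.
move=> a0; rewrite /todd_ratio tdZ big_split /= prodr_const card_ord.
by rewrite -mulf_div divff ?mul1r // expf_neq0.
Qed.

Lemma eq_todd_ratio k (t t' : 'I_k -> rat) : t =1 t' -> todd_ratio t = todd_ratio t'.
Proof.
by move=> tt'; rewrite /todd_ratio (eq_td tt') (eq_bigr t').
Qed.

Lemma common_denominator (T : finType) (f : T -> rat) :
  exists2 a : rat, 0 < a & forall i, a * f i \is a Num.int.
Proof.
exists (\prod_i (denq (f i))%:~R); first by rewrite prodr_gt0 // => i _;
  rewrite ltr0z denq_gt0.
move=> i; rewrite (bigD1 i) //= mulrAC.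
have -> : (denq (f i))%:~R * f i = (numq (f i))%:~R.
  by rewrite -[X in _ * X]divq_num_den mulrC divfK // intr_eq0 denq_neq0.
by rewrite rpredM ?rpred_prod // => *; apply: intr_int.
Qed.

Section BasisChange.
Variables (n k : nat) (J : finType) (eps : J -> rat) (V : {vspace 'rV[rat]_n}).
Variables (w : J -> 'I_k -> 'rV[rat]_n) (d : J -> 'I_k -> 'cV[rat]_n).
Hypothesis d_dual : forall j i l, pairing (d j i) (w j l) = (i == l)%:R.
Hypothesis w_span : forall j x, x \in V -> x = \sum_i pairing (d j i) x *: w j i.
Hypothesis w_mem : forall j i, w j i \in V.
Hypothesis d_int : forall j i l h, pairing (d j i) (w h l) \is a Num.int.
Variable u : 'rV[rat]_n.
Hypothesis uV : u \in V.
Hypothesis u_gen : forall j i, pairing (d j i) u != 0.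
Hypothesis flips : forall m,
  \sum_j eps j * \prod_i flip (pairing (d j i) u) (pairing m (w j i)) = 0.

(** Relative to the basis [j0] all bases are given by unimodular integer matrices; scaling [u] makes
    its coordinates integral and leaves the ratios unchanged. *)
Lemma todd_ratio_bases (j0 : J) :
  \sum_j eps j * todd_ratio (fun i => pairing (d j i) u) = 0.
Proof.
have [a a0 a_int] := common_denominator (fun ji : J * 'I_k => pairing (d ji.1 ji.2) u).
pose t j i := Num.floor (a * pairing (d j i) u).
have tE j i : (t j i)%:~R = a * pairing (d j i) u.
  by apply/eqP; rewrite -intrEfloor; apply: (a_int (j, i)).
pose A j : 'M[int]_k := \matrix_(l, i) Num.floor (pairing (d j0 l) (w j i)).
pose B j : 'M[int]_k := \matrix_(i, l) Num.floor (pairing (d j i) (w j0 l)).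
have floorE j i h l : (Num.floor (pairing (d j i) (w h l)))%:~R = pairing (d j i) (w h l).
  by apply/eqP; rewrite -intrEfloor d_int.
have AB j : A j *m B j = 1%:M.
  apply/matrixP => l i; apply: (@intr_inj rat).
  rewrite !mxE rmorph_sum /= rmorph_nat -(d_dual j0 l i) [X in _ = pairing _ X](w_span
    j (w_mem _ _)).
  rewrite pairing_sumr; apply: eq_bigr => h _.
  by rewrite !mxE rmorphM /= !floorE pairingZr mulrC.
have BA j : B j *m A j = 1%:M.
  apply/matrixP => l i; apply: (@intr_inj rat).
  rewrite !mxE rmorph_sum /= rmorph_nat -(d_dual j l i) [X in _ = pairing _ X](w_span
    j0 (w_mem _ _)).
  rewrite pairing_sumr; apply: eq_bigr => h _.
  by rewrite !mxE rmorphM /= !floorE pairingZr mulrC.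
pose dual_vec (b : 'rV[int]_k) : 'cV[rat]_n := \sum_l (b 0 l)%:~R *: d j0 l.
have bA j b i : ((b *m A j) 0 i)%:~R = pairing (dual_vec b) (w j i).
  rewrite mxE rmorph_sum pairing_suml; apply: eq_bigr => l _.
  by rewrite mxE rmorphM /= floorE pairingZl.
have := @td_sum_of_flips J k eps t A B (t j0) _ AB BA _ _; rewrite /= => td0.
rewrite -[RHS]td0; first last.
- move=> b; rewrite -[RHS](flips (dual_vec b)); apply: eq_bigr => j _.
  congr (_ * _); apply: eq_bigr => i _; rewrite bA tE /flip; congr (_%:R - _).
  by rewrite pmulr_rgt0.
- move=> j b; apply: (@intr_inj rat); rewrite !rmorph_sum /=.
  have -> : \sum_i (t j i * (b *m A j) 0 i)%:~R = a * pairing (dual_vec b) u.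
    rewrite [X in pairing _ X](w_span j uV) pairing_sumr mulr_sumr.
    by apply: eq_bigr => i _; rewrite rmorphM /= bA tE pairingZr mulrA.
  rewrite pairing_suml mulr_sumr; apply: eq_bigr => i _.
  by rewrite rmorphM /= tE pairingZl mulrAC -mulrA.
- move=> j i; rewrite -(intr_eq0 rat) tE mulf_neq0 //; exact: lt0r_neq0.
apply: eq_bigr => j _; congr (_ * _); rewrite -(todd_ratioZ _ (lt0r_neq0 a0)).
by apply: eq_todd_ratio => i; rewrite tE.
Qed.

End BasisChange.

Section Enumeration.
Variables (I : finType) (k : nat).

Definition enum_at (S : {set I}) (e : #|S| = k) (i : 'I_k) : I :=
  enum_val (cast_ord (esym e) i).

Lemma enum_atP (S : {set I}) (e : #|S| = k) i : enum_at e i \in S.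
Proof. exact: enum_valP. Qed.

Lemma enum_at_inj (S : {set I}) (e : #|S| = k) : injective (enum_at e).
Proof. by move=> i j /enum_val_inj /cast_ord_inj. Qed.

Lemma big_enum_at (R : Type) (idx : R) (op : Monoid.com_law idx) (S : {set I})
    (e : #|S| = k) (f : I -> R) :
  \big[op/idx]_(i in S) f i = \big[op/idx]_(i < k) f (enum_at e i).
Proof.
rewrite /enum_at; case: k / e => /=; rewrite big_enum_val.
by apply: eq_bigr => i _; rewrite cast_ord_id.
Qed.

End Enumeration.

(** * Independence of the subdivision *)

Section FacetRatio.
Variables (n : nat).

Definition facet_ratio (I : finType) (v : I -> 'rV[rat]_n) (S : {set I}) u : rat :=
  todd_ratio (fun i : 'I_#|S| => pairing (dual v S (enum_val i)) u).

Lemma facet_ratioE (I : finType) (v : I -> 'rV[rat]_n) (S : {set I}) u k (e : #|S| = k) :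
  facet_ratio v S u = todd_ratio (fun i => pairing (dual v S (enum_at e i)) u).
Proof.
rewrite /facet_ratio /enum_at; case: k / e.
by apply: eq_todd_ratio => i; rewrite cast_ord_id.
Qed.

Definition unimodular (I : finType) (v : I -> 'rV[rat]_n) (K : {set {set I}}) :=
  forall S, facet v K S -> forall i, i \in S -> lattice (v i) /\
    forall x, lattice x -> x \in sspan v (finset.cover K) ->
      pairing (dual v S i) x \is a Num.int.

Lemma csupport_cover (I1 I2 : finType) (v1 : I1 -> 'rV[rat]_n) (v2 : I2 -> 'rV[rat]_n)
    (K1 : {set {set I1}}) (K2 : {set {set I2}}) :
  csupport v1 K1 `<=` csupport v2 K2 ->
  (sspan v1 (finset.cover K1) <= sspan v2 (finset.cover K2))%VS.
Proof.
move=> K12; apply/span_subvP => _ /mapP[i + ->]; rewrite mem_enum.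
by move=> /(csupport_mem v1)/K12/csupport_span.
Qed.

Section TwoComplexes.
Variables (I1 I2 : finType) (v1 : I1 -> 'rV[rat]_n) (v2 : I2 -> 'rV[rat]_n).
Variables (K1 : {set {set I1}}) (K2 : {set {set I2}}) (u : 'rV[rat]_n).
Hypotheses (cK1 : convex_complex v1 K1) (cK2 : convex_complex v2 K2).
Hypotheses (uni1 : unimodular v1 K1) (uni2 : unimodular v2 K2).
Hypotheses (g1 : generic v1 K1 u) (g2 : generic v2 K2 u).
Hypothesis supp : csupport v1 K1 = csupport v2 K2.

Let V := sspan v1 (finset.cover K1).

(** The facets of both complexes form one family of lattice bases of [V], signed [1] and [-1]. The
    flips cancel at every [m] by [flip_sum_invariant], so the Todd ratios cancel too. *)
Lemma facet_ratio_invariant :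
  \sum_(S | facet v1 K1 S) facet_ratio v1 S u =
  \sum_(S | facet v2 K2 S) facet_ratio v2 S u.
Proof.
have VE : sspan v2 (finset.cover K2) = V.
  by apply/eqP; rewrite eqEsubv !csupport_cover // supp.
pose k := \dim V.
pose J : finType := ({T | facet v1 K1 T} + {T | facet v2 K2 T})%type.
have card1 (S : {T | facet v1 K1 T}) : #|val S| = k by have /andP[_ /eqP] := valP S.
have card2 (S : {T | facet v2 K2 T}) : #|val S| = k.
  by have /andP[_ /eqP ->] := valP S; rewrite VE.
pose w (j : J) (i : 'I_k) : 'rV[rat]_n := match j with
  | inl A => v1 (enum_at (card1 A) i) | inr A => v2 (enum_at (card2 A) i) end.
pose d (j : J) (i : 'I_k) : 'cV[rat]_n := match j with
  | inl A => dual v1 (val A) (enum_at (card1 A) i)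
  | inr A => dual v2 (val A) (enum_at (card2 A) i) end.
pose eps (j : J) : rat := if j is inl _ then 1 else -1.
have big_facets (f : J -> rat) : \sum_j eps j * f j =
    \sum_(S : {T | facet v1 K1 T}) f (inl S) - \sum_(S : {T | facet v2 K2 T}) f (inr S).
  rewrite big_sumType /= -sumrN; congr (_ + _); apply: eq_bigr => S _.
    by rewrite mul1r.
  by rewrite mulN1r.
have big_val1 (f : {set I1} -> rat) :
    \sum_(S | facet v1 K1 S) f S = \sum_(S : {T | facet v1 K1 T}) f (val S).
  exact: (big_sub (facet v1 K1)).
have big_val2 (f : {set I2} -> rat) :
    \sum_(S | facet v2 K2 S) f S = \sum_(S : {T | facet v2 K2 T}) f (val S).
  exact: (big_sub (facet v2 K2)).
have indep1 (S : {T | facet v1 K1 T}) : indep v1 (val S).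
  by have /andP[KS _] := valP S; apply: (complex_indep cK1).
have indep2 (S : {T | facet v2 K2 T}) : indep v2 (val S).
  by have /andP[KS _] := valP S; apply: (complex_indep cK2).
have span1 (S : {T | facet v1 K1 T}) : sspan v1 (val S) = V.
  by rewrite (sspan_facet cK1 (valP S)).
have span2 (S : {T | facet v2 K2 T}) : sspan v2 (val S) = V.
  by rewrite (sspan_facet cK2 (valP S)).
have w_mem j i : w j i \in V.
  case: j => S /=; first by rewrite -(span1 S) mem_sspan // enum_atP.
  by rewrite -(span2 S) mem_sspan // enum_atP.
have w_lat j i : lattice (w j i).
  case: j => S /=; first by have [] := uni1 (valP S) (enum_atP (card1 S) i).
  by have [] := uni2 (valP S) (enum_atP (card2 S) i).
have [_ t1] := g1; have [_ t2] := g2.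
have uV : u \in V by case: g1.
have [S0 fS0 _] := csupport_facet cK1 (csupport0 cK1).
suff : \sum_j eps j * todd_ratio (fun i => pairing (d j i) u) = 0.
  rewrite big_facets => /eqP; rewrite subr_eq0 => /eqP.
  rewrite big_val1 big_val2 => E.
  rewrite (eq_bigr _ (fun S _ => facet_ratioE v1 u (card1 S))).
  by rewrite (eq_bigr _ (fun S _ => facet_ratioE v2 u (card2 S))).
apply: (@todd_ratio_bases n k J eps V w d) => //; last exact: (inl (exist _ S0 fS0)).
- case=> S i l /=.
    by rewrite (dualP (indep1 S)) ?enum_atP // (inj_eq (@enum_at_inj _ _ _ _)).
  by rewrite (dualP (indep2 S)) ?enum_atP // (inj_eq (@enum_at_inj _ _ _ _)).
- case=> S x xV /=.
    rewrite -(span1 S) in xV.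
    by rewrite [LHS](sspanP (indep1 S) xV) (big_enum_at _ (card1 S)).
  rewrite -(span2 S) in xV.
  by rewrite [LHS](sspanP (indep2 S) xV) (big_enum_at _ (card2 S)).
- case=> S i l h /=.
    by have [_ ->] := uni1 (valP S) (enum_atP (card1 S) i).
  by have [_ ->] := uni2 (valP S) (enum_atP (card2 S) i); rewrite ?VE.
- case=> S i /=; first exact: t1 (valP S) (enum_atP _ _).
  exact: t2 (valP S) (enum_atP _ _).
move=> m; rewrite big_facets; apply/eqP; rewrite subr_eq0; apply/eqP.
have := flip_sum_invariant m cK1 cK2 supp g1 g2.
rewrite /flip_sum big_val1 big_val2.
rewrite (eq_bigr _ (fun S _ => big_enum_at _ (card1 S) _)) => ->.
by rewrite (eq_bigr _ (fun S _ => big_enum_at _ (card2 S) _)).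
Qed.

End TwoComplexes.
End FacetRatio.

(** * Nonsingular fans *)

Section ConeGeometry.
Variable n : nat.
Implicit Types (C T : set 'rV[rat]_n) (s l : seq 'rV[rat]_n) (x g h v w : 'rV[rat]_n).

Lemma cone_hull1 g x : cone_hull [:: g] x <-> exists2 a, 0 <= a & x = a *: g.
Proof.
split=> [/cone_hull_cons[a [y [a0 [c _ ->] ->]]]|[a a0 ->]].
  by exists a => //; rewrite big_ord0 addr0.
by apply: cone_hullZ => //; apply: cone_hull_mem; rewrite mem_head.
Qed.

Lemma cone_hull_pos_eq0 l m y : (forall h, h \in l -> 0 < pairing m h) ->
  cone_hull l y -> pairing m y = 0 -> y = 0.
Proof.
move=> lpos [c c0 ->]; rewrite pairing_sumr.
have ge0 (i : 'I_(size l)) : true -> 0 <= pairing m (c i *: l`_i).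
  by move=> _; rewrite pairingZr mulr_ge0 // ltW // lpos ?mem_nth.
move=> /(psumr_eq0P ge0) ceq0; apply: big1 => i _; have := ceq0 i isT.
move=> /eqP; rewrite pairingZr mulf_eq0 [X in _ || X]gt_eqF ?lpos ?mem_nth // orbF.
by move=> /eqP ->; rewrite scale0r.
Qed.

(** Take a shortest generating list. Farkas' lemma gives, for each other generator [h], a functional
    zero at [g], nonnegative on the list and positive at [h]; otherwise [g] would be redundant or
    the cone would contain a line. The sum of these functionals cuts out the ray of [g]. *)
Lemma cone_extreme_rays C : is_cone C ->
  exists2 l, C = cone_hull l &
    forall g, g \in l -> g != 0 /\ is_face (cone_hull [:: g]) C.
Proof.
move=> [[s sC] ptd].
pose P j := `[< exists2 l, size l = j & C = cone_hull l >].
have exP : exists j, P j by exists (size s); apply/asboolP; exists s.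
case: (ex_minnP exP) => j /asboolP[l lj lC] minj; exists l => // g gl.
pose l' := rem g l.
have lE : cone_hull l = cone_hull (g :: l').
  have memE := perm_mem (perm_to_rem gl); apply/seteqP.
  by split; apply: cone_hull_sub => h hl; apply: cone_hull_mem; move: hl; rewrite memE.
have irred : ~ cone_hull l' g.
  move=> l'g; have : P (size l').
    apply/asboolP; exists l' => //; rewrite lC lE; apply/seteqP.
    split; apply: cone_hull_sub => h; last by move=> hl'; apply: cone_hull_mem;
      rewrite inE hl' orbT.
    by rewrite inE => /predU1P[->//|]; apply: cone_hull_mem.
  by move=> /minj; rewrite -lj size_rem // leqNgt ltn_predL; case: l gl {lj lC lE l' l'g}.
have g0 : g != 0 by apply/eqP => g0; apply: irred; rewrite g0; apply: cone_hull0.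
have l'C : cone_hull l' `<=` C.
  rewrite lC lE; apply: cone_hull_sub => h hl'.
  by apply: cone_hull_mem; rewrite inE hl' orbT.
have gC : C g by rewrite lC; apply: cone_hull_mem.
have CD x y : C x -> C y -> C (x + y) by rewrite lC; apply: cone_hullD.
have CZ a x : 0 <= a -> C x -> C (a *: x) by rewrite lC; apply: cone_hullZ.
have ex_m h : exists m, h \in l' -> h != 0 ->
    [/\ pairing m g = 0, forall h', h' \in l' -> 0 <= pairing m h' & 0 < pairing m h].
  case: (boolP ((h \in l') && (h != 0))) => [/andP[hl' h0]|nh]; last first.
    by exists 0 => hl' h0; move: nh; rewrite hl' h0.
  have [|m ml mh] := @farkas n (g :: - g :: l') (- h).
    move=> /cone_hull_cons[a [_ [a0 /cone_hull_cons[b [y [b0 l'y ->]]]]]].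
    rewrite scalerN addrA -scalerBl => E.
    have E' : y + h = (b - a) *: g.
      by rewrite -[b - a]opprB scaleNr; apply/eqP;
        rewrite -addr_eq0 -addrA [h + _]addrC addrA [y + _]addrC -E addNr.
    have l'h : cone_hull l' h by apply: cone_hull_mem.
    have [ba|ba] := ltP 0 (b - a).
      apply: irred; rewrite (_ : g = (b - a)^-1 *: (y + h)).
        by apply: cone_hullZ; [rewrite invr_ge0 ltW | apply: cone_hullD].
      by rewrite E' scalerA mulVf ?scale1r // gt_eqF.
    move/negP: h0; apply; apply/eqP; apply: ptd; first exact: l'C.
    rewrite E; apply: CD; last exact: l'C.
    by apply: CZ => //; rewrite -oppr_le0 opprB.
  exists m => _ _; split.
  - apply/eqP; rewrite eq_le -oppr_ge0 -pairingNr !ml // !inE eqxx ?orbT //.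
  - by move=> h' hl; rewrite ml // !inE hl !orbT.
  - by move: mh; rewrite pairingNr oppr_lt0.
have [f fP] := choice ex_m.
have l'0 h : h \in l' -> h != 0.
  move=> hl'; apply/eqP => h0; have hl : h \in l by apply: mem_rem hl'.
  have : P (size (rem h l)).
    apply/asboolP; exists (rem h l) => //; rewrite lC; apply/seteqP.
    split; apply: cone_hull_sub => h' h'l; last by apply: cone_hull_mem; apply: mem_rem h'l.
    have [->|h'0] := eqVneq h' 0; first exact: cone_hull0.
    apply: cone_hull_mem; move: h'l; rewrite (perm_mem (perm_to_rem hl)) inE.
    by rewrite h0 (negPf h'0).
  by move=> /minj; rewrite -lj size_rem // leqNgt ltn_predL;
    case: l hl {gl lj lC lE l' irred l'C hl' ex_m f fP}.
pose m := \sum_(h <- l') f h.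
have mg : pairing m g = 0.
  rewrite pairing_suml big_seq big1 // => h hl'.
  by have [->] := fP h hl' (l'0 h hl').
have ml' h : h \in l' -> 0 < pairing m h.
  move=> hl'; rewrite pairing_suml (big_rem h) //=.
  have [_ _ fh] := fP h hl' (l'0 h hl').
  rewrite ltr_wpDr // big_seq sumr_ge0 // => h' /mem_rem h'l.
  by have [_ + _] := fP h' h'l (l'0 h' h'l); apply.
split=> //; exists m.
  rewrite lC lE => _ /cone_hull_cons[a [y [a0 l'y ->]]].
  rewrite pairingDr pairingZr mg mulr0 add0r.
  by apply: pairing_cone_hull l'y => h /ml'/ltW.
apply/seteqP; split=> [_ /cone_hull1[a a0 ->]|x [Cx]].
  by split; [apply: CZ | rewrite /= pairingZr mg mulr0].
move: Cx; rewrite lC lE => /cone_hull_cons[a [y [a0 l'y ->]]] /=.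
rewrite pairingDr pairingZr mg mulr0 add0r => /(cone_hull_pos_eq0 ml' l'y) ->.
by rewrite addr0; apply/cone_hull1; exists a.
Qed.

End ConeGeometry.

Section ConeLemmas.
Variable n : nat.
Implicit Types (C T : set 'rV[rat]_n) (s l : seq 'rV[rat]_n) (x g h v w : 'rV[rat]_n).

Lemma is_coneD C x y : is_cone C -> C x -> C y -> C (x + y).
Proof. by move=> [[s ->] _]; apply: cone_hullD. Qed.

Lemma is_coneZ C a x : is_cone C -> 0 <= a -> C x -> C (a *: x).
Proof. by move=> [[s ->] _]; apply: cone_hullZ. Qed.

Lemma is_cone0 C : is_cone C -> C 0.
Proof. by move=> [[s ->] _]; apply: cone_hull0. Qed.

Lemma is_face_sub T C : is_face T C -> T `<=` C.
Proof. by move=> [m _ ->] x []. Qed.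

Lemma is_face_refl C : is_face C C.
Proof.
exists 0; first by move=> v _; rewrite pairing0l.
by apply/seteqP; split=> [x Cx|x [] //]; split=> //=; rewrite pairing0l.
Qed.

Lemma cspan_mem C x : is_cone C -> C x -> x \in cspan C.
Proof. by move=> cC Cx; have [sub _] := cspan_min cC; apply: sub. Qed.

Lemma first_lattice_pointP C v : first_lattice_point C v <->
  [/\ lattice v, C v, v != 0 &
      forall w, lattice w -> C w -> exists a : nat, w = v *+ a].
Proof.
have CU : [set x + y | x in C & y in [set` (0%VS : {vspace 'rV[rat]_n})]] = C.
  apply/seteqP; split=> [_ [x Cx [y y0 <-]]|x Cx].
    by move: y0; rewrite /= memv0 => /eqP ->; rewrite addr0.
  by exists x => //; exists 0; rewrite ?addr0 //= mem0v.
rewrite /first_lattice_point /first_lattice_point_mod; cbv zeta; rewrite CU memv0.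
split=> -[lv Cv v0 vP]; split=> // w lw Cw; have [a] := vP w lw Cw.
  by rewrite memv0 subr_eq0 => /eqP ->; exists a.
by move=> ->; exists a; rewrite subrr mem0v.
Qed.

Lemma first_lattice_point_unique C v w :
  first_lattice_point C v -> first_lattice_point C w -> v = w.
Proof.
move=> /first_lattice_pointP[lv Cv v0 vP] /first_lattice_pointP[lw Cw w0 wP].
have [a wE] := vP w lw Cw; have [b vE] := wP v lv Cv.
have : (1 - (a * b)%:R : rat) *: v == 0.
  by rewrite scalerBl scale1r scaler_nat subr_eq0 mulrnA -wE -vE.
rewrite scaler_eq0 (negPf v0) orbF subr_eq0 (eqr_nat _ 1) eq_sym muln_eq1.
by move=> /andP[/eqP a1 _]; rewrite wE a1.
Qed.

Lemma lattice_basis_free U s : is_lattice_basis U s -> free s.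
Proof.
move=> [sU sB]; apply/(@freeP _ _ _ (in_tuple s)) => k k0 i.
have [a a0 a_int] := common_denominator k.
have /sB -/(_ (mem0v _))[z [zE zuniq]] : lattice (0 : 'rV[rat]_n).
  by move=> j; rewrite mxE rpred0.
have floorE (j : 'I_(size s)) : (Num.floor (a * k j))%:~R = a * k j.
  by apply/eqP; rewrite -intrEfloor.
have e1 : z = [ffun j => Num.floor (a * k j)].
  apply: zuniq; rewrite -[LHS](scaler0 _ a) -[X in a *: X = _]k0 scaler_sumr.
  by apply: eq_bigr => j _; rewrite ffunE floorE scalerA.
have e2 : z = [ffun j => 0].
  by apply: zuniq; rewrite big1 // => j _; rewrite ffunE scale0r.
have := floorE i; move: e1; rewrite e2 => /ffunP/(_ i); rewrite !ffunE => <- /esym/eqP.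
by rewrite mulf_eq0 gt_eqF //= => /eqP.
Qed.

Lemma lattice_basis_span U s : is_lattice_basis U s -> <<s>>%VS = U.
Proof.
move=> [sU sB]; apply/eqP; rewrite eqEsubv; apply/andP; split.
  by apply/span_subvP => v /sU[].
apply/subvP => x xU; have [a a0 a_int] := common_denominator (fun i => x 0 i).
have /sB -/(_ _)[|z [zE _]] : lattice (a *: x) by move=> i; rewrite mxE.
  by rewrite memvZ.
rewrite -[x]scale1r -(mulVf (lt0r_neq0 a0)) -scalerA memvZ // zE.
by apply: memv_suml => i _; rewrite memvZ // memv_span // mem_nth.
Qed.

End ConeLemmas.

(** * Cones and rays of a nonsingular fan *)

Section NonsingularFan.
Variables (n : nat) (X : fan n).
Hypothesis nsX : nonsingular_fan X.
Implicit Types (s t r : X) (S : {set X}).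

Definition is_ray r := cdim (fan_cone r) == 1%N.

Definition ray_vec r : 'rV[rat]_n := xget 0 (first_lattice_point (fan_cone r)).

Definition rays s : {set X} := [set r | is_ray r && `[< fan_cone r `<=` fan_cone s >]]%SET.

Lemma rays_is_ray s r : r \in rays s -> is_ray r.
Proof. by rewrite inE => /andP[]. Qed.

Lemma raysP s r : r \in rays s -> fan_cone r `<=` fan_cone s.
Proof. by rewrite inE => /andP[_ /asboolP]. Qed.

Lemma fan_face_sub s t : fan_cone s `<=` fan_cone t -> is_face (fan_cone s) (fan_cone t).
Proof. by move=> st; have := fan_inter t s; rewrite setIidr. Qed.

Lemma ray_first r : is_ray r -> first_lattice_point (fan_cone r) (ray_vec r).
Proof.
move=> /eqP dr; rewrite /ray_vec; case: xgetP => [v -> //|none].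
have [G [uG rG] bG] := nsX r; have cr := fan_is_cone r.
have sizeG : size G = 1%N.
  by have := lattice_basis_free bG; rewrite /free (lattice_basis_span bG) => /eqP <-.
case: G sizeG uG rG bG => // v [|//] _ uG rG bG.
have /rG[T [Tr _ /first_lattice_pointP[lv Tv v0 _]]] : v \in [:: v] by rewrite mem_head.
have rv : fan_cone r v := is_face_sub Tr Tv.
case: (none v); apply/first_lattice_pointP; split=> // w lw rw.
have [_ /(_ w lw (cspan_mem cr rw))[z [wE _]]] := bG.
have [[a|a] {}wE] : exists a : int, w = a%:~R *: v by exists (z ord0); rewrite wE big_ord1.
  by exists a; rewrite wE -scaler_nat -pmulrn.
have [_ ptd] := cr; move/eqP: v0; case; apply: ptd => //.
have -> : - v = w + (a%:R : rat) *: v.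
  rewrite wE NegzE mulrNz -scalerDl -scaleN1r; congr (_ *: _).
  by rewrite -pmulrn -natr1; ring.
by apply: is_coneD => //; apply: is_coneZ.
Qed.

Lemma ray_vec_neq0 r : is_ray r -> ray_vec r != 0.
Proof. by move=> /ray_first/first_lattice_pointP[]. Qed.

Lemma ray_vec_mem r : is_ray r -> fan_cone r (ray_vec r).
Proof. by move=> /ray_first/first_lattice_pointP[]. Qed.

Lemma ray_cone r x : is_ray r -> fan_cone r x -> exists2 a, 0 <= a & x = a *: ray_vec r.
Proof.
move=> rr rx; have cr := fan_is_cone r; have [_ ptd] := cr.
have v0 := ray_vec_neq0 rr; have rv := ray_vec_mem rr.
have spanE : cspan (fan_cone r) = <[ray_vec r]>%VS.
  apply/eqP; rewrite eq_sym eqEdim -memvE cspan_mem //= dim_vline v0.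
  by rewrite -/(cdim (fan_cone r)) (eqP rr).
have : x \in cspan (fan_cone r) by apply: cspan_mem.
rewrite spanE => /vlineP[a xE]; exists a => //; rewrite leNgt; apply/negP => a0.
move/negP: v0; apply; apply/eqP; apply: ptd => //.
rewrite (_ : - ray_vec r = (- a)^-1 *: x).
  by apply: is_coneZ => //; rewrite invr_ge0 oppr_ge0 ltW.
by rewrite xE scalerA invrN mulNr mulVf ?lt_eqF // scaleN1r.
Qed.

Lemma ray_vec_inj s : {in rays s &, injective ray_vec}.
Proof.
have sub r r' : is_ray r -> is_ray r' -> ray_vec r = ray_vec r' ->
    fan_cone r `<=` fan_cone r'.
  move=> rr rr' e x /(ray_cone rr)[a a0 ->]; rewrite e.
  by apply: is_coneZ (fan_is_cone _) a0 (ray_vec_mem rr').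
move=> r r' /rays_is_ray rr /rays_is_ray rr' e; apply: fan_injective.
by apply/seteqP; split; apply: sub.
Qed.

Lemma fan_cone_rays s : fan_cone s = scone ray_vec (rays s).
Proof.
have cs := fan_is_cone s; apply/seteqP; split=> [x|_ [a a0 ->]]; last first.
  apply: big_ind => [||r rs]; [exact: is_cone0 | by move=> x y; apply: is_coneD |].
  apply: is_coneZ => //; apply: (raysP rs); apply: ray_vec_mem; exact: rays_is_ray rs.
have [l lE lP] := cone_extreme_rays cs; rewrite {1}lE => -[c c0 ->].
apply: big_ind => [||i _]; [exact: scone0 | exact: sconeD | apply: sconeZ => //].
have [g0 gface] := lP _ (mem_nth 0 (ltn_ord i)); set g := l`_i in g0 gface *.
have [r rE] := fan_face gface.
have rr : is_ray r.
  by rewrite /is_ray rE /cdim cspan_hull span_seq1 dim_vline g0.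
have rs : r \in rays s by rewrite inE rr; apply/asboolP; rewrite rE; apply: is_face_sub.
have [|a a0 ->] := @ray_cone r g rr; last by apply: sconeZ => //; apply: scone_mem.
by rewrite rE; apply: cone_hull_mem; rewrite mem_head.
Qed.

Lemma ray_gens_rays s G : is_ray_gens (fan_cone s) G ->
  perm_eq G [seq ray_vec r | r <- enum (rays s)].
Proof.
move=> [uG GP]; apply: uniq_perm => //.
  rewrite map_inj_in_uniq ?enum_uniq // => r r'; rewrite !mem_enum.
  exact: ray_vec_inj.
move=> v; apply/idP/mapP => [/GP[T [Ts dT vT]]|[r]].
  have [r rE] := fan_face Ts.
  have rr : is_ray r by rewrite /is_ray rE dT.
  exists r; first by rewrite mem_enum inE rr; apply/asboolP; rewrite rE; apply: is_face_sub.
  by apply: (@first_lattice_point_unique _ T) => //; rewrite -rE; apply: ray_first.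
rewrite mem_enum => rs ->; apply/GP; exists (fan_cone r); split.
- exact/fan_face_sub/raysP.
- exact/eqP/(rays_is_ray rs).
- exact/ray_first/(rays_is_ray rs).
Qed.

Lemma rays_indep s : indep ray_vec (rays s).
Proof.
have [G rG /lattice_basis_free frG] := nsX s; apply/indep_free.
by rewrite -(perm_free (ray_gens_rays rG)).
Qed.

Lemma cspan_rays s : cspan (fan_cone s) = sspan ray_vec (rays s).
Proof.
have [G rG bG] := nsX s; rewrite -(lattice_basis_span bG).
exact: eq_span (perm_mem (ray_gens_rays rG)).
Qed.

Lemma cdim_rays s : cdim (fan_cone s) = #|rays s|.
Proof. by rewrite /cdim cspan_rays dim_sspan //; apply: rays_indep. Qed.

Lemma ray_vec_lattice r : is_ray r -> lattice (ray_vec r).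
Proof. by move=> /ray_first/first_lattice_pointP[]. Qed.

Lemma rays_unimodular s r x : r \in rays s -> lattice x -> x \in cspan (fan_cone s) ->
  pairing (dual ray_vec (rays s) r) x \is a Num.int.
Proof.
move=> rs lx xs; have [G rG [_ bG]] := nsX s; have [z [-> _]] := bG x lx xs.
rewrite pairing_sumr rpred_sum // => i _; rewrite pairingZr rpredM ?intr_int //.
have : G`_i \in G by rewrite mem_nth.
rewrite (perm_mem (ray_gens_rays rG)) => /mapP[r' +  ->]; rewrite mem_enum => r's.
rewrite dualP //; [by case: (_ == _) | exact: rays_indep].
Qed.

Lemma rays_subset s t : (rays s \subset rays t) <-> fan_cone s `<=` fan_cone t.
Proof.
split=> [st x|st]; first by rewrite !fan_cone_rays; apply: sconeS.
apply/fintype.subsetP => r; rewrite !inE => /andP[-> /asboolP rs].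
by apply/asboolP => x /rs/st.
Qed.

Lemma rays_inj : injective rays.
Proof. by move=> s t st; apply: fan_injective; rewrite !fan_cone_rays st. Qed.

Lemma ray_vec_scone s S r : S \subset rays s -> is_ray r ->
  scone ray_vec S (ray_vec r) -> r \in S.
Proof.
move=> Ss rr Sv; have iS := @rays_indep s.
have rs : r \in rays s.
  rewrite inE rr; apply/asboolP => x /(ray_cone rr)[a a0 ->].
  by rewrite fan_cone_rays; apply: sconeZ => //; apply: sconeS Sv.
case: Sv => a a0 vE; have := dualP iS rs rs.
rewrite {1}vE -(sum_extend _ _ Ss) pairing_dual_sum // eqxx.
by case: ifP => // _ /eqP; rewrite eq_sym oner_eq0.
Qed.

(** The sum of the coordinates outside [S] is nonnegative on the cone and vanishes exactly on the
    subcone of [S], which is therefore a face. *)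
Lemma fan_down s S : S \subset rays s -> exists t, rays t = S.
Proof.
move=> Ss; have iS := @rays_indep s.
pose m := \sum_(r in rays s :\: S) dual ray_vec (rays s) r.
have mv r : r \in rays s -> pairing m (ray_vec r) = (r \notin S)%:R.
  move=> rs; rewrite pairing_suml.
  rewrite (eq_bigr (fun r' => (r' == r)%:R)); last first.
    by move=> r'; rewrite inE => /andP[_ r's]; rewrite dualP.
  have [rS|rS] := boolP (r \in S).
    rewrite big1 // => r'; rewrite inE => /andP[r'S _].
    by case: eqP r'S => // ->; rewrite rS.
  rewrite (bigD1 r) /=; last by rewrite inE rS.
  by rewrite eqxx big1 ?addr0 // => r' /andP[_ /negPf ->].
have ge0 x : fan_cone s x -> 0 <= pairing m x.
  rewrite fan_cone_rays => -[a a0 ->]; rewrite pairing_sumr sumr_ge0 // => r rs.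
  by rewrite pairingZr mulr_ge0 // mv // ler0n.
have face : is_face (scone ray_vec S) (fan_cone s).
  exists m => //; apply/seteqP; split=> [x Sx|x [+ /= mx]].
    split; first by rewrite fan_cone_rays; apply: sconeS Sx.
    case: Sx => a a0 ->; rewrite /= pairing_sumr big1 // => r rS.
    by rewrite pairingZr mv ?rS ?mulr0 // (fintype.subsetP Ss).
  rewrite fan_cone_rays => -[a a0 xE]; exists a => //.
  have term0 r : r \in rays s -> 0 <= pairing m (a r *: ray_vec r).
    by move=> rs; rewrite pairingZr mv // mulr_ge0.
  move: mx; rewrite {1}xE pairing_sumr => /(psumr_eq0P term0) aeq0.
  rewrite xE (bigID (mem S)) /= [X in _ + X]big1 ?addr0 => [|r /andP[rs rS]].
    by apply: eq_bigl => r; rewrite andbC;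
      case: (boolP (r \in S)) => //= /(fintype.subsetP Ss).
  have /eqP := aeq0 r rs; rewrite pairingZr mv // rS mulr1 => /eqP ->.
  by rewrite scale0r.
have [t tE] := fan_face face; exists t; apply/finset.setP => r; apply/idP/idP.
  move=> rt; have rr := rays_is_ray rt; apply: (ray_vec_scone Ss) => //.
  by rewrite -tE; apply: (raysP rt); apply: ray_vec_mem.
move=> rS; have rr := rays_is_ray (fintype.subsetP Ss _ rS).
rewrite inE rr; apply/asboolP => x /(ray_cone rr)[a a0 ->].
by rewrite tE; apply: sconeZ => //; apply: scone_mem.
Qed.

Lemma rays_inter s t x : scone ray_vec (rays s) x -> scone ray_vec (rays t) x ->
  scone ray_vec (rays s :&: rays t)%SET x.
Proof.
rewrite -!fan_cone_rays => sx tx; have [w wE] := fan_face (fan_inter s t).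
have : fan_cone w x by rewrite wE.
rewrite fan_cone_rays; apply: sconeS; apply/fintype.subsetP => r rw.
have rr := rays_is_ray rw; have sub := raysP rw; rewrite wE in sub.
by rewrite !inE rr /=; apply/andP; split; apply/asboolP => y /sub[].
Qed.

Definition fan_complex : {set {set X}} := [set rays s | s in [set: X]]%SET.

Lemma csupport_fan : csupport ray_vec fan_complex = Defs.support X.
Proof.
apply/seteqP; split=> x.
  by move=> [S /imsetP[s _ ->] Sx]; exists s; rewrite fan_cone_rays.
move=> [s sx]; exists (rays s); last by rewrite -fan_cone_rays.
by apply/imsetP; exists s.
Qed.

Lemma fan_convex_complex :
  (forall x y, Defs.support X x -> Defs.support X y -> Defs.support X (x + y)) ->
  convex_complex ray_vec fan_complex.
Proof.
move=> conv; split.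
- have /card_gt0P[s _] := fan_inhabited X.
  have [t tE] := fan_down (finset.sub0set (rays s)).
  by apply/imsetP; exists t.
- move=> S _ /imsetP[s _ ->] /fan_down[t <-]; by apply/imsetP; exists t.
- move=> _ /imsetP[s _ ->]; exact: rays_indep.
- move=> _ _ x /imsetP[s _ ->] /imsetP[t _ ->]; exact: rays_inter.
- by rewrite csupport_fan.
Qed.

Lemma fan_cover_span C : is_cone C -> Defs.support X = C ->
  sspan ray_vec (finset.cover fan_complex) = cspan C.
Proof.
move=> cC XC; apply/eqP; rewrite eqEsubv; apply/andP; split.
  apply/span_subvP => _ /mapP[r + ->]; rewrite mem_enum => rK.
  apply: cspan_mem => //; rewrite -XC -csupport_fan; exact: csupport_mem.
have [_ min] := cspan_min cC; apply: min => x Cx /=.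
by apply: csupport_span; rewrite csupport_fan XC.
Qed.

Lemma fan_facetE C s : is_cone C -> Defs.support X = C ->
  facet ray_vec fan_complex (rays s) = (cdim (fan_cone s) == cdim C).
Proof.
move=> cC XC; rewrite /facet (fan_cover_span cC XC) -cdim_rays.
by rewrite (_ : rays s \in fan_complex = true) //; apply/imsetP; exists s.
Qed.

Lemma fan_unimodular C : is_cone C -> Defs.support X = C -> unimodular ray_vec fan_complex.
Proof.
move=> cC XC S fS; have [/imsetP[s _ SE] _] := andP fS; subst S.
move=> r rs; split; first exact/ray_vec_lattice/(rays_is_ray rs).
move=> x lx; rewrite (fan_cover_span cC XC) => xC; apply: rays_unimodular => //.
suff -> : cspan (fan_cone s) = cspan C by [].
apply/eqP; rewrite eqEdim; have := fan_facetE s cC XC; rewrite fS => /esym/eqP.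
rewrite /cdim => ->; rewrite leqnn andbT.
have [_ min] := cspan_min (fan_is_cone s); apply: min => y sy /=.
by apply: cspan_mem => //; rewrite -XC; exists s.
Qed.

End NonsingularFan.

(** * The ring of torus-invariant cycles *)

Section Projection.
Variables (n : nat) (U W : {vspace 'rV[rat]_n}).
Hypotheses (UW : (U + W)%VS = fullv) (UIW : (U :&: W)%VS = 0%VS).

Lemma perp_cap : (perp U :&: perp W)%VS = 0%VS.
Proof.
apply/eqP; rewrite -subv0; apply/subvP => m; rewrite memv_cap => /andP[/perpP mU /perpP mW].
rewrite memv0; apply/eqP/matrixP => i j; rewrite ord1 [RHS]mxE.
have /memv_addP[x xU [y yW e]] : delta_mx 0 i \in (U + W)%VS by rewrite UW memvf.
have := pairingDr m x y; rewrite -e (mU _ xU) (mW _ yW) addr0 => <-.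
rewrite /pairing mxE (bigD1 i) //= !mxE !eqxx mul1r big1 ?addr0 // => l li.
by rewrite mxE (negPf li) mul0r.
Qed.

(** The form [q], equal to [m] on [W] and to 0 on [U], splits [m] as an element of [perp U] plus one
    of [perp W]. Hence the complementary projection accounts for [m - p], which vanishes on [W]. *)
Lemma perp_proj m : let p := daddv_pi (perp U) (perp W) m in
  (forall x, x \in U -> pairing p x = 0) /\
  (forall x, x \in W -> pairing p x = pairing m x).
Proof.
move=> p; have pU : p \in perp U by apply: memv_pi.
have WIU : (W :&: U)%VS = 0%VS by rewrite capvC.
have [|q qE] := @pairing_represent n (fun x => pairing m (daddv_pi W U x)).
  by move=> a x y; rewrite linearP pairingDr pairingZr.
have qU : q \in perp U.
  apply/perpP => x xU; rewrite qE.
  have := daddv_pi_add UIW (_ : x \in (U + W)%VS); rewrite UW memvf => /(_ isT).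
  rewrite daddv_pi_id // => /eqP; rewrite -[X in _ == X]addr0 (inj_eq (addrI x)) => /eqP ->.
  exact: pairing0r.
have mqW : m - q \in perp W.
  apply/perpP => x xW; rewrite pairingDl -scaleN1r pairingZl qE daddv_pi_id //.
  by rewrite mulN1r subrr.
have mE : p + daddv_pi (perp W) (perp U) m = m.
  apply: (daddv_pi_add perp_cap); rewrite -(subrK q m) addrC memv_add //.
split=> x xUW; first exact: (perpP _ _).1 pU x xUW.
rewrite -[X in _ = pairing X _]mE pairingDl.
have /perpP/(_ x xUW) -> := memv_pi (perp W) (perp U) m.
by rewrite addr0.
Qed.

End Projection.

(** * Lines cut out by the flag *)

Section FlagCoordinates.
Variables (n : nat) (F : nat -> {vspace 'rV[rat]_n}) (X : fan n).
Hypotheses (flagF : complete_flag F) (nsX : nonsingular_fan X).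
Hypothesis domX : forall s : X, in_domain F (fan_cone s).
Implicit Types (s t r w i : X) (S : {set X}).

Local Notation rays := (@rays n X).
Local Notation ray_vec := (@ray_vec n X).

(** For a ray [i] of [w], the facet of [w] opposite to [i]; it exists by [fan_down]. *)
Definition delete w i : X := xget w [set t | rays t = (rays w :\ i)%SET].

Lemma rays_delete w i : rays (delete w i) = (rays w :\ i)%SET.
Proof.
rewrite /delete; case: xgetP => // none.
by have [t tE] := fan_down nsX (finset.subD1set (rays w) i); case: (none t).
Qed.

Lemma delete_inj w : {in rays w &, injective (delete w)}.
Proof.
move=> i j iw jw e; have /finset.setP/(_ i) : rays (delete w i) = rays (delete w j) by
  rewrite e.
by rewrite !rays_delete !finset.in_setD1 eqxx iw /= andbT => /esym/negbFE/eqP.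
Qed.

Lemma card_rays_leq s : (#|rays s| <= n)%N.
Proof.
rewrite -(cdim_rays nsX); apply: leq_trans (dimvS (subvf _)) _.
by rewrite dimvf /dim /= mul1n.
Qed.

Lemma flag_complement s :
  (cspan (fan_cone s) + F (n - #|rays s|))%VS = fullv /\
  (cspan (fan_cone s) :&: F (n - #|rays s|))%VS = 0%VS.
Proof.
have := domX (is_face_refl (fan_cone s)).
by rewrite /complement_map (cdim_rays nsX).
Qed.

(* A spanning vector of the line [F (n - k + 1) :&: span w], [w] of dimension
   [k]. *)
Definition flag_vec w : 'rV[rat]_n :=
  vpick (F (n - #|rays w| + 1) :&: cspan (fan_cone w))%VS.

(** Zero at the rays outside [w], so that [mul_ray] holds for every ray. *)
Definition flag_coord w r : rat :=
  if r \in rays w then pairing (dual ray_vec (rays w) r) (flag_vec w) else 0.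

Lemma flag_vec_mem w : flag_vec w \in (F (n - #|rays w| + 1) :&: cspan (fan_cone w))%VS.
Proof. exact: memv_pick. Qed.

(** The space that cuts the line out of the span of [w] is thus the complement attached to each
    facet of [w]. *)
Lemma delete_index w i : i \in rays w -> (n - #|rays w| + 1 = n - #|rays (delete w i)|)%N.
Proof.
move=> iw; rewrite rays_delete (cardsD1 i (rays w)) iw /=.
have := card_rays_leq w; rewrite (cardsD1 i (rays w)) iw; lia.
Qed.

Lemma mem_delete_span w i x : i \in rays w -> x \in cspan (fan_cone w) ->
  pairing (dual ray_vec (rays w) i) x = 0 -> x \in cspan (fan_cone (delete w i)).
Proof.
move=> iw; rewrite !cspan_rays // rays_delete => xw x0.
rewrite (sspanP (@rays_indep _ _ nsX w) xw) (bigD1 i) //= x0 scale0r add0r.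
rewrite (eq_bigl (mem (rays w :\ i)%SET)); first exact: sspan_sum.
by move=> j; rewrite /= finset.in_setD1 andbC.
Qed.

(** If the coordinate vanishes, [x] is in the span of the facet opposite to [i] and also in its
    complement. *)
Lemma flag_line_coord w i x : i \in rays w ->
  x \in (F (n - #|rays w| + 1) :&: cspan (fan_cone w))%VS ->
  pairing (dual ray_vec (rays w) i) x = 0 -> x = 0.
Proof.
move=> iw; rewrite memv_cap => /andP[xF xw] x0; apply/eqP; rewrite -memv0.
have [_ <-] := flag_complement (delete w i).
by rewrite memv_cap mem_delete_span // -delete_index.
Qed.

Lemma flag_vec_neq0 w : (0 < #|rays w|)%N -> flag_vec w != 0.
Proof.
move=> w0; rewrite vpick0 -dimv_eq0 -lt0n.
have ln := card_rays_leq w; have [dF _] := flagF.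
have := dimv_sum_cap (F (n - #|rays w| + 1)) (cspan (fan_cone w)).
have dw : \dim (cspan (fan_cone w)) = #|rays w| := cdim_rays nsX w.
rewrite dw dF; last by lia.
have : (\dim (F (n - #|rays w| + 1) + cspan (fan_cone w)) <= n)%N.
  by apply: leq_trans (dimvS (subvf _)) _; rewrite dimvf /dim /= mul1n.
by move: (\dim (_ + _)) (\dim (_ :&: _)) => a b; lia.
Qed.

Lemma flag_coord_neq0 w i : i \in rays w -> flag_coord w i != 0.
Proof.
move=> iw; rewrite /flag_coord iw; apply/eqP => /(flag_line_coord iw (flag_vec_mem w)).
by apply/eqP/flag_vec_neq0; rewrite (cardsD1 i) iw.
Qed.

Lemma flag_line w : (0 < #|rays w|)%N ->
  (F (n - #|rays w| + 1) :&: cspan (fan_cone w))%VS = <[flag_vec w]>%VS.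
Proof.
move=> w0; apply/eqP; rewrite eqEsubv -[X in _ && X]memvE flag_vec_mem andbT.
apply/subvP => x xFw; have [i iw] := card_gt0P w0.
have := flag_coord_neq0 iw; rewrite /flag_coord iw => c0.
apply/vlineP; exists (pairing (dual ray_vec (rays w) i) x / pairing (dual ray_vec (rays
  w) i) (flag_vec w)).
apply/eqP; rewrite -subr_eq0; apply/eqP; apply: (flag_line_coord iw).
  by rewrite memvB // memvZ // flag_vec_mem.
by rewrite pairingBr pairingZr divfK ?subrr.
Qed.

Lemma flag_vecE w : flag_vec w = \sum_(i in rays w) flag_coord w i *: ray_vec i.
Proof.
have := flag_vec_mem w; rewrite memv_cap cspan_rays // => /andP[_ vw].
rewrite [LHS](sspanP (@rays_indep _ _ nsX w) vw).
by apply: eq_bigr => i iw; rewrite /flag_coord iw.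
Qed.

End FlagCoordinates.

(** * The commutative ring of cycles *)

Section CycleRing.
Variables (n : nat) (F : nat -> {vspace 'rV[rat]_n}) (X : fan n).
Variable mul : cycles X -> cycles X -> cycles X.

(** A synonym of [cycles X] that carries the proof of the product axioms, so that the ring structure
    can be attached to it. *)
Definition cycle_ring of is_cycle_product F mul := cycles X.

Variable mulP : is_cycle_product F mul.

HB.instance Definition _ := GRing.Lmodule.on (cycle_ring mulP).

Let mulDr (x y z : cycles X) : mul x (y + z) = mul x y + mul x z.
Proof. by have := cycle_mul_linear mulP x 1 y z; rewrite !scale1r. Qed.

Let mulDl : left_distributive (mul : cycle_ring mulP -> _) +%R.
Proof.
by move=> x y z; rewrite !(cycle_mulC mulP _ z); apply: mulDr.
Qed.

HB.instance Definition _ := GRing.Zmodule_isComPzRing.Build (cycle_ring mulP)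
  (cycle_mulA mulP) (cycle_mulC mulP) (cycle_mul1 mulP) mulDl.

Lemma cycle_scaleAr (a : rat) (x y : cycle_ring mulP) : x * (a *: y) = a *: (x * y).
Proof.
have x0 : mul x 0 = 0 := mulr0 (x : cycle_ring mulP).
by have := cycle_mul_linear mulP x a y 0; rewrite x0 !addr0.
Qed.

Lemma cycle_scaler_prod (I : Type) (l : seq I) (P : pred I) (a : I -> rat)
    (x : I -> cycle_ring mulP) :
  \prod_(i <- l | P i) (a i *: x i) = \prod_(i <- l | P i) a i *: \prod_(i <- l | P i) x i.
Proof.
elim/big_rec3: _ => [|i b y z _ ->]; first by rewrite scale1r.
by rewrite cycle_scaleAr mulrC cycle_scaleAr scalerA; congr (_ *: _); rewrite mulrC.
Qed.

Lemma cycle_expansion (z : cycles X) : z = \sum_t z t *: orbit_closure t.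
Proof.
apply/ffunP => w; rewrite sum_ffunE (bigD1 w) //= !ffunE eqxx big1 => [|t tw].
  by rewrite addr0 /GRing.scale /= mulr1.
by rewrite !ffunE eq_sym (negPf tw) /GRing.scale /= mulr0.
Qed.

End CycleRing.

(** * Coefficients of products of ray divisors *)

Section Intersections.
Variables (n : nat) (F : nat -> {vspace 'rV[rat]_n}) (X : fan n).
Variable mul : cycles X -> cycles X -> cycles X.
Hypotheses (flagF : complete_flag F) (nsX : nonsingular_fan X).
Hypothesis domX : forall s : X, in_domain F (fan_cone s).
Hypothesis mulP : is_cycle_product F mul.
Implicit Types (s t r w i : X) (S : {set X}) (l : seq X).

Local Notation rays := (@rays n X).
Local Notation ray_vec := (@ray_vec n X).
Local Notation delete := (@delete n X).
Local Notation coord := (@flag_coord n F X).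
Local Notation V := (@orbit_closure n X : X -> cycle_ring mulP).

Lemma maximal_above w : exists2 s, maximal_cone s & rays w \subset rays s.
Proof.
have [s ws smax] := @arg_maxnP X w (fun s => rays w \subset rays s) (fun s => #|rays
  s|) (subxx _).
exists s => // t /(rays_subset nsX) st; apply: (rays_inj nsX); apply/eqP.
by rewrite eq_sym eqEcard st /=; apply: smax; apply: fintype.subset_trans ws st.
Qed.

Lemma face_rays s r v : is_face (fan_cone r) (fan_cone s) ->
  cdim (fan_cone r) = 1%N -> first_lattice_point (fan_cone r) v ->
  r \in rays s /\ v = ray_vec r.
Proof.
move=> rs dr rv; have rr : is_ray r by rewrite /is_ray dr.
split; first by rewrite inE rr; apply/asboolP; apply: is_face_sub.
by apply: (first_lattice_point_unique rv); apply: (ray_first nsX).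
Qed.

Let equation r s : 'cV[rat]_n := if r \in rays s then dual ray_vec (rays s) r else 0.

Lemma pairing_equation r s i : i \in rays s ->
  pairing (equation r s) (ray_vec i) = (i == r)%:R.
Proof.
move=> is_; rewrite /equation; case: (boolP (r \in rays s)) => [rs|nrs].
  by rewrite dualP ?[r == i]eq_sym //; apply: rays_indep.
by rewrite pairing0l; case: eqP nrs => // <-; rewrite is_.
Qed.

Lemma ray_local_equations r : is_ray r -> local_equations (V r) (equation r).
Proof.
move=> rr; split=> [i di|s i v _ is_ di iv].
  by rewrite ffunE; case: eqP di rr => // -> /eqP/negPf; rewrite /is_ray => ->.
have [is' ->] := face_rays is_ di iv.
by rewrite pairing_equation // ffunE.
Qed.

(** Modulo the span of the facet opposite to [i], a lattice point of the span of [w] is determined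
    by its coordinate at [i], which is an integer by nonsingularity and nonnegative on the cone. *)
Lemma ray_vec_first_mod w i : i \in rays w ->
  first_lattice_point_mod (cspan (fan_cone (delete w i))) (fan_cone w) (ray_vec i).
Proof.
move=> iw; have ri := rays_is_ray iw; have iS := @rays_indep _ _ nsX w.
split.
- exact: ray_vec_lattice.
- exists (ray_vec i); last by exists 0; rewrite ?addr0 //= mem0v.
  by apply: (raysP iw); apply: ray_vec_mem.
- rewrite cspan_rays // rays_delete //; apply/negP => iD.
  have [a] : exists a : X -> rat, ray_vec i = \sum_(j in rays w :\ i) a j *: ray_vec j.
    exists (fun j => pairing (dual ray_vec (rays w :\ i) j) (ray_vec i)).
    by apply: sspanP iD; apply: indepS iS; apply: finset.subD1set.
  rewrite -(sum_extend _ _ (finset.subD1set (rays w) i)) => e.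
  have := dualP iS iw iw; rewrite e pairing_dual_sum // finset.in_setD1 !eqxx /=.
  by move=> /eqP; rewrite eq_sym oner_eq0.
move=> x lx [c wc [y /= yD xE]].
have yw : y \in cspan (fan_cone w).
  move: yD; rewrite !cspan_rays // rays_delete //; apply: subvP; apply: sspanS.
  exact: finset.subD1set.
have cw : c \in cspan (fan_cone w) by apply: cspan_mem => //; apply: fan_is_cone.
have xw : x \in cspan (fan_cone w) by rewrite -xE memvD.
have dy : pairing (dual ray_vec (rays w) i) y = 0.
  move: yD; rewrite cspan_rays // rays_delete // => yD.
  have iD : indep ray_vec (rays w :\ i) by apply: indepS iS; apply: finset.subD1set.
  rewrite (sspanP iD yD) -(sum_extend _ _ (finset.subD1set (rays w) i)).
  by rewrite pairing_dual_sum // finset.in_setD1 eqxx.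
have dx : pairing (dual ray_vec (rays w) i) x \is a Num.int by apply: rays_unimodular.
have dx0 : 0 <= pairing (dual ray_vec (rays w) i) x.
  rewrite -xE pairingDr dy addr0; move: wc; rewrite fan_cone_rays //.
  by move=> /(sconeP _ iS)[_]; apply.
have /natrP[a aE] : pairing (dual ray_vec (rays w) i) x \is a Num.nat by rewrite
  natrEint dx.
exists a; apply: mem_delete_span => //.
  by rewrite memvB // -scaler_nat memvZ // cspan_mem //;
    [exact: fan_is_cone | apply: (raysP iw); apply: ray_vec_mem].
by rewrite pairingBr -scaler_nat pairingZr dualP // eqxx mulr1 aE subrr.
Qed.

(** The projected local equation vanishes on the span of the facet and keeps its values on the
    complement, which contains [flag_vec w]. Evaluating at that vector gives [coord w i] times the
    coefficient on one side and [coord w r] on the other. *)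
Lemma mul_orbit_facet r w i : is_ray r -> i \in rays w ->
  (V r * V (delete w i)) w = coord w r / coord w i.
Proof.
move=> rr iw; have ri := rays_is_ray iw; have iS := @rays_indep _ _ nsX w.
have [_ rest] := cycle_mul_divisor mulP (delete w i) (ray_local_equations rr).
have [s smax ws] := maximal_above w.
have sub : rays (delete w i) \subset rays w by rewrite rays_delete // finset.subD1set.
have -> : (V r * V (delete w i)) w =
    pairing (flag_proj F (fan_cone (delete w i)) (equation r s)) (ray_vec i).
  apply: (rest w s (ray_vec i)) => //; last exact: ray_vec_first_mod.
    split; first by apply/fan_face_sub/rays_subset.
    by rewrite !cdim_rays // rays_delete // (cardsD1 i (rays w)) iw.
  by apply/fan_face_sub/rays_subset.
have [UW UIW] := flag_complement nsX domX (delete w i).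
have [pU pW] := perp_proj UW UIW (equation r s).
rewrite /flag_proj /complement_map cdim_rays //; set p := daddv_pi _ _ _ in pU pW *.
have ci0 := flag_coord_neq0 flagF nsX domX iw.
apply: (mulIf ci0); rewrite divfK // mulrC.
have vF : flag_vec F w \in F (n - #|rays (delete w i)|)%N.
  by rewrite -(delete_index nsX iw); have := flag_vec_mem F w; rewrite memv_cap => /andP[].
have := pW _ vF; rewrite (flag_vecE F nsX w) !pairing_sumr.
rewrite (bigD1 i) //= pairingZr big1 ?addr0 => [->|j /andP[jw ji]]; last first.
  rewrite pairingZr pU ?mulr0 // cspan_rays // mem_sspan // rays_delete //.
  by rewrite finset.in_setD1 ji.
rewrite (eq_bigr (fun j => coord w j * (j == r)%:R)); last first.
  by move=> j jw; rewrite pairingZr pairing_equation // (fintype.subsetP ws).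
have [rw|rw] := boolP (r \in rays w).
  rewrite (bigD1 r) //= eqxx mulr1 big1 ?addr0 // => j /andP[_ /negPf ->].
  by rewrite mulr0.
rewrite big1 => [|j jw]; first by rewrite /flag_coord (negPf rw).
by case: eqP jw rw => [->->|]; rewrite ?mulr0.
Qed.

Lemma mul_orbit_other r w t : is_ray r -> (forall i, i \in rays w -> t != delete w i) ->
  (V r * V t) w = 0.
Proof.
move=> rr tw; have [zero _] := cycle_mul_divisor mulP t (ray_local_equations rr).
apply: zero => -[/is_face_sub/(rays_subset nsX) sub]; rewrite !cdim_rays // => card.
have /card_gt0P[i] : (0 < #|rays w :\: rays t|)%N.
  by rewrite cardsDS // card subSn // subnn.
rewrite finset.in_setD => /andP[it iw]; move/negP: (tw i iw); apply; apply/eqP.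
apply: (rays_inj nsX); rewrite rays_delete //; apply/eqP; rewrite eqEcard.
apply/andP; split; last by move: card; rewrite (cardsD1 i (rays w)) iw add1n => -[->].
apply/fintype.subsetP => j jt; rewrite finset.in_setD1 (fintype.subsetP sub) // andbT.
by apply: contraNneq it => <-.
Qed.

(** Only the facets of [w] contribute, and [r] enters each contribution through the same factor. *)
Lemma mul_ray r (z : cycle_ring mulP) w : is_ray r ->
  (V r * z) w = coord w r * \sum_(i in rays w) (z : cycles X) (delete w i) / coord w i.
Proof.
move=> rr; rewrite [z in LHS]cycle_expansion mulr_sumr sum_ffunE mulr_sumr.
rewrite (eq_bigr (fun t => \sum_(i in rays w | delete w i == t)
    coord w r * ((z : cycles X) (delete w i) / coord w i))).
  by rewrite -(partition_big (delete w) xpredT).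
move=> t _; rewrite cycle_scaleAr ffunE.
have [i /andP[iw /eqP it]|none] := pickP [pred i | (i \in rays w) && (delete w i == t)].
  rewrite -it mul_orbit_facet // (big_pred1 i) => [|j /=].
    by rewrite /GRing.scale /=; ring.
  have [jw|jw] := boolP (j \in rays w) => /=.
    by apply/eqP/eqP => [/(delete_inj nsX jw iw)|->].
  by apply/esym/eqP => ji; rewrite ji iw in jw.
rewrite mul_orbit_other ?big_pred0 ?scaler0 //.
by move=> i iw; have := none i; rewrite /= iw /= eq_sym => /negbT.
Qed.

Definition monomial l : cycle_ring mulP := \prod_(r <- l) V r.

Lemma monomial_cons r l w : is_ray r ->
  monomial (r :: l) w =
  coord w r * \sum_(i in rays w) monomial l (delete w i) / coord w i.
Proof. by move=> rr; rewrite /monomial big_cons mul_ray. Qed.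

Lemma perm_monomial l l' : perm_eq l l' -> monomial l = monomial l'.
Proof. exact: perm_big. Qed.

Lemma unit_coef w : monomial [::] w = (rays w == finset.set0)%:R.
Proof.
rewrite /monomial big_nil.
have -> : (1 : cycle_ring mulP) w = `[< fan_cone w = [set 0] >]%:R by rewrite [LHS]ffunE.
congr (_ %:R); congr nat_of_bool; apply/asboolP/eqP => [w0|w0].
  apply/finset.setP => i; rewrite finset.in_set0; apply/negP => iw.
  have ri := rays_is_ray iw.
  have : fan_cone w (ray_vec i) by apply: (raysP iw); apply: ray_vec_mem.
  by rewrite w0 => /= /eqP; rewrite (negPf (ray_vec_neq0 nsX ri)).
rewrite fan_cone_rays // w0; apply/seteqP; split=> x /=.
  by move=> [a _ ->]; rewrite big_set0.
by move=> ->; apply: scone0.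
Qed.

Lemma monomial_degree l w : all (@is_ray n X) l -> size l != #|rays w| ->
  monomial l w = 0.
Proof.
elim: l w => [|r l IH] w /=.
  by move=> _; rewrite unit_coef eq_sym cards_eq0 => /negPf ->.
move=> /andP[rr lr] sl; rewrite monomial_cons // big1 ?mulr0 // => i iw.
rewrite IH ?mul0r // rays_delete //; apply: contraNneq sl => ->.
by rewrite [X in _ == X](cardsD1 i) iw.
Qed.

Lemma monomial_notin r l w : all (@is_ray n X) l -> r \in l -> r \notin rays w ->
  monomial l w = 0.
Proof.
move=> lr rl rw; rewrite (perm_monomial (perm_to_rem rl)) monomial_cons.
  by rewrite /flag_coord (negPf rw) mul0r.
exact: (allP lr).
Qed.

Lemma all_rays w : all (@is_ray n X) (enum (rays w)).
Proof. by apply/allP => r; rewrite mem_enum => /rays_is_ray. Qed.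

(** With [r] in front, a facet opposite to another ray [i] contributes nothing, as [i] still occurs
    in the product; the facet opposite to [r] gives 1 by induction. *)
Lemma monomial_rays w : monomial (enum (rays w)) w = 1.
Proof.
have [k] := ubnP #|rays w|; elim: k w => // k IH w; rewrite ltnS => wk.
have [w0|[r rw]] := finset.set_0Vmem (rays w).
  by rewrite w0 finset.enum_set0 unit_coef w0 eqxx.
have pr : perm_eq (enum (rays w)) (r :: enum (rays w :\ r)%SET).
  apply: uniq_perm; rewrite ?enum_uniq //=.
    by rewrite mem_enum finset.in_setD1 eqxx enum_uniq.
  move=> i; rewrite in_cons !mem_enum finset.in_setD1.
  by case: eqP => [->|].
rewrite (perm_monomial pr) monomial_cons; last exact: rays_is_ray rw.
have cr0 := flag_coord_neq0 flagF nsX domX rw.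
rewrite (bigD1 r) //= big1 ?addr0 => [|i /andP[iw ir]].
  rewrite -(rays_delete nsX w r) IH ?mul1r ?mulfV //.
  by move: wk; rewrite rays_delete // (cardsD1 r (rays w)) rw.
rewrite (@monomial_notin i) ?mul0r //.
- by apply/allP => j; rewrite mem_enum finset.in_setD1 => /andP[_ /rays_is_ray].
- by rewrite mem_enum finset.in_setD1 ir.
- by rewrite rays_delete // finset.in_setD1 eqxx.
Qed.

(* By [monomial_cons], [coord w r' * monomial (r :: l) w] is symmetric in [r]
   and [r'], so rays may be exchanged one at a time. *)
Lemma monomial_exchange w l l' p : size l = size l' ->
  all (@is_ray n X) l -> all (@is_ray n X) l' ->
  monomial (p ++ l) w * \prod_(r <- l') coord w r =
  monomial (p ++ l') w * \prod_(r <- l) coord w r.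
Proof.
elim: l l' p => [|r l IH] [|r' l'] p //= [sl] /andP[rr lr] /andP[rr' lr'].
have front (q : seq X) s (q' : seq X) : monomial (q ++ s :: q') = monomial (s :: q ++ q').
  by apply: perm_monomial; rewrite perm_catC /= perm_cons perm_catC.
have -> : monomial (p ++ r' :: l') w = monomial ((r' :: p) ++ l') w by rewrite front.
have e1 : monomial (p ++ r :: l) w * coord w r' = monomial ((r' :: p) ++ l) w * coord w r.
  by rewrite front /= !monomial_cons //; ring.
have e2 := IH l' (r' :: p) sl lr lr'.
rewrite !big_cons mulrA e1 mulrAC e2; ring.
Qed.

(** Exchange the rays of [l] against the product of the rays of [w], whose coefficient is 1. *)
Lemma monomialE l w : all (@is_ray n X) l ->
  monomial l w = (size l == #|rays w|)%:R *
    (\prod_(r <- l) coord w r / \prod_(i in rays w) coord w i).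
Proof.
move=> lr; have [sl|sl] := eqVneq; last by rewrite monomial_degree ?mul0r.
rewrite mul1r; have c0 : \prod_(i in rays w) coord w i != 0.
  by apply/prodf_neq0 => i iw; apply: flag_coord_neq0.
apply: (mulIf c0); rewrite divfK //.
have := @monomial_exchange w l (enum (rays w)) [::] _ lr (all_rays w).
rewrite /= monomial_rays mul1r -cardE => /(_ sl) <-.
by rewrite big_enum.
Qed.

Lemma todd_poly0 N : todd_poly N.+1 0 = 1.
Proof.
apply/polyP => j; rewrite coef_poly coef1; case: j => [|j] /=.
  have := todd_coefP 0; rewrite big_ord1 /= subnn !expr0 factS fact0.
  by rewrite muln1 divr1.
by rewrite expr0n /= mulr0; case: ifP.
Qed.

(** By [monomialE] the coefficient of a monomial in the divisors is the same monomial in the numbers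
    [coord w r], cut to degree [k] and divided by the product over the rays of [w]. So the Todd
    class becomes the degree [k] part of a product of Todd series. *)
Lemma todd_class_coef w k (e : #|rays w| = k) :
  todd_class mul w = todd_ratio (fun i : 'I_k => coord w (enum_at e i)).
Proof.
have -> : todd_class mul = (\prod_(r | is_ray r) \sum_(j < n.+1)
    todd_coef j *: V r ^+ j : cycle_ring mulP).
  apply: eq_big => [r|r _]; first by rewrite /is_ray; apply/asboolP/eqP.
  apply: eq_bigr => j _; congr (_ *: _).
  by elim: (nat_of_ord j) => [|i IH]; rewrite ?expr0 //= IH exprS.
pose T := \prod_(r | is_ray r) \sum_(j < n.+1) (todd_coef j * coord w r ^+ j) *: 'X^j :
  {poly rat}.
have -> : todd_ratio (fun i : 'I_k => coord w (enum_at e i)) =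
    T`_k / \prod_(i in rays w) coord w i.
  rewrite /todd_ratio (big_enum_at _ e); congr (_ / _).
  rewrite (@td_coef n.+1) -?e ?ltnS ?card_rays_leq //; congr ((_ : {poly rat})`_ _).
  rewrite -(big_enum_at _ e (fun i => todd_poly n.+1 (coord w i))).
  (* The rays outside [w] have coordinate 0, and the Todd series has constant term 1. *)
  rewrite /T [RHS](bigID (mem (rays w))) /= [X in _ = _ * X]big1 ?mulr1.
    apply: eq_big => [r|r _]; last by rewrite /todd_poly poly_def.
    by case: (boolP (r \in rays w)) => [/rays_is_ray ->|_]; rewrite ?andbF.
  move=> r /andP[_ rw].
  by rewrite -[RHS](todd_poly0 n) /todd_poly poly_def /flag_coord (negPf rw).
rewrite /T !(big_distr_big ord0) /= sum_ffunE coef_sum mulr_suml.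
apply: eq_bigr => f _; rewrite cycle_scaler_prod ffunE scaler_prod coefZ.
pose l := flatten [seq nseq (f r) r | r <- enum X & is_ray r].
have lE (R : Type) (idx : R) (op : Monoid.com_law idx) (x : X -> R) :
    \big[op/idx]_(r <- l) x r = \big[op/idx]_(r | is_ray r) iter (f r) (op (x r)) idx.
  rewrite big_flatten big_map big_filter big_enum_cond; apply: eq_bigr => r _.
  exact: big_nseq.
have -> : \prod_(r | is_ray r) V r ^+ f r = monomial l.
  rewrite /monomial lE; apply: eq_bigr => r _.
  by elim: (nat_of_ord (f r)) => [|j IH]; rewrite ?expr0 //= -IH exprS.
rewrite monomialE; last first.
  by apply/allP => r /flatten_mapP[r']; rewrite mem_filter => /andP[rr' _] /nseqP[-> _].
have -> : \prod_(r <- l) coord w r = \prod_(r | is_ray r) coord w r ^+ f r.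
  rewrite lE; apply: eq_bigr => r _.
  by elim: (nat_of_ord (f r)) => [|j IH]; rewrite ?expr0 //= IH exprS.
have -> : size l = (\sum_(r | is_ray r) f r)%N.
  rewrite -sum1_size lE; apply: eq_bigr => r _.
  by elim: (nat_of_ord (f r)) => //= j ->.
rewrite -expr_sum coefXn big_split /= e eq_sym /GRing.scale /=.
by ring.
Qed.

End Intersections.

(** * Todd measure and Morelli's function *)

Section RestrictedFan.
Variables (n : nat) (X : fan n) (C : set 'rV[rat]_n).

Definition restricted_index : finType := {s : X | `[< fan_cone s `<=` C >]}.

Definition restricted_cone (s : restricted_index) : set 'rV[rat]_n := fan_cone (val s).

Lemma restricted_inj : injective restricted_cone.
Proof. by move=> s t /fan_injective /val_inj. Qed.

Lemma restricted_face s T : is_face T (restricted_cone s) ->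
  exists t, restricted_cone t = T.
Proof.
move=> Ts; have [t tE] := fan_face Ts.
have tC : `[< fan_cone t `<=` C >].
  by apply/asboolP; rewrite tE; apply: subset_trans (is_face_sub Ts) (asboolP _ (valP s)).
by exists (Sub t tC).
Qed.

Lemma restricted_inter s t :
  is_face (restricted_cone s `&` restricted_cone t) (restricted_cone s).
Proof. exact: fan_inter. Qed.

Hypothesis inhC : (0 < #|restricted_index|)%N.

Definition restricted_fan : fan n :=
  Fan inhC restricted_inj (fun s => fan_is_cone (val s)) restricted_face restricted_inter.

Lemma restricted_nonsingular : nonsingular_fan X -> nonsingular_fan restricted_fan.
Proof. by move=> nsX s; apply: nsX. Qed.

End RestrictedFan.

(** A cone [s'] at [v] lies in a cone [s1] of the coarse fan, and the functional cutting the
    intersection of [s1] and [s] out of [s1] also makes the intersection of [s'] and [s] a face of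
    [s'], hence a cone of the fine fan. *)
Lemma subdivision_restricts n (X X' : fan n) (s : X) v : fan_subdivides X' X ->
  fan_cone s v -> exists2 t : X', fan_cone t `<=` fan_cone s & fan_cone t v.
Proof.
move=> [suppE sub] sv; have : Defs.support X' v by rewrite suppE; exists s.
move=> [s' s'v]; have [s1 s's1] := sub s'.
have [m mge0 mE] := fan_inter s1 s.
have face : is_face (fan_cone s' `&` fan_cone s) (fan_cone s').
  exists m; first by move=> x /s's1/mge0.
  apply/seteqP; split=> x [s'x].
    move=> sx; split=> //; have : (fan_cone s1 `&` fan_cone s) x by split=> //; apply: s's1.
    by rewrite mE => -[].
  move=> mx; have : (fan_cone s1 `&` [set y | pairing m y = 0]) x by split=> //;
    apply: s's1.
  by rewrite -mE => -[].
have [t tE] := fan_face face; exists t; rewrite tE //; exact: subIsetr.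
Qed.

(** Written with products over the set [S], the ratio shows no trace of the order in which [p] lists
    [S]. *)
Lemma todd_ratio_image (I : finType) (S : {set I}) k (p : 'I_k -> I) (f : I -> rat) :
  #|S| = k -> injective p -> (forall i, p i \in S) ->
  todd_ratio (fun i => f (p i)) =
  (\prod_(i in S) todd_poly k.+1 (f i))`_k / \prod_(i in S) f i.
Proof.
move=> cS pinj pS.
have SE : S = (p @: [set: 'I_k])%SET.
  apply/esym/eqP; rewrite eqEcard card_imset // cardsT card_ord cS leqnn andbT.
  by apply/fintype.subsetP => _ /imsetP[i _ ->].
have reidx (R : comNzRingType) (g : I -> R) : \prod_(i in S) g i = \prod_i g (p i).
  rewrite SE big_imset /=; last by move=> i j _ _ /pinj.
  by apply: eq_bigl => i; rewrite inE.
by rewrite /todd_ratio (@td_coef k.+1) // !reidx.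
Qed.

(** * Values of Morelli's function on subdivisions *)

Section MorelliValue.
Variables (n : nat) (X : fan n).
Hypothesis nsX : nonsingular_fan X.
Implicit Types (s : X) (E : {vspace 'rV[rat]_n}).

Local Notation rays := (@rays n X).
Local Notation ray_vec := (@ray_vec n X).

Lemma morelli_nonsingular_exists k s E u (e : #|rays s| = k) :
  (E :&: cspan (fan_cone s))%VS = <[u]>%VS ->
  (forall i, i \in rays s -> pairing (dual ray_vec (rays s) i) u != 0) ->
  is_morelli_nonsingular k (fan_cone s) E (facet_ratio ray_vec (rays s) u).
Proof.
move=> Eu u0; exists [tuple ray_vec (enum_at e i) | i < k].
exists (fun i => pairing (dual ray_vec (rays s) (enum_at e i)) u); split.
- have [G [uG GP] _] := nsX s; have pG := ray_gens_rays nsX (conj uG GP).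
  have -> : tval [tuple ray_vec (enum_at e i) | i < k] = [seq ray_vec r | r <- enum
    (rays s)].
    rewrite map_enum_tuple /enum_at; case: k / e => /=.
    by apply: eq_map => i; rewrite cast_ord_id.
  split; first by rewrite -(perm_uniq pG).
  by move=> v; rewrite -(perm_mem pG).
- have us : u \in cspan (fan_cone s).
    by have : u \in (E :&: cspan (fan_cone s))%VS;
      [rewrite Eu memv_line | rewrite memv_cap => /andP[]].
  rewrite Eu; congr <[_]>%VS; rewrite cspan_rays // in us.
  rewrite [LHS](sspanP (@rays_indep _ _ nsX s) us) (big_enum_at _ e).
  by apply: eq_bigr => i _; rewrite tnth_mktuple.
- by move=> i; apply/u0/enum_atP.
- exact: facet_ratioE.
Qed.

(** The list of rays is determined up to order and the spanning vector up to a nonzero factor; the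
    ratio depends on neither. *)
Lemma morelli_nonsingular_value k s E u q : (0 < k)%N -> #|rays s| = k ->
  (E :&: cspan (fan_cone s))%VS = <[u]>%VS ->
  is_morelli_nonsingular k (fan_cone s) E q ->
  (forall i, i \in rays s -> pairing (dual ray_vec (rays s) i) u != 0) /\
  q = facet_ratio ray_vec (rays s) u.
Proof.
move=> k0 e Eu [w [t [/(ray_gens_rays nsX) pw Ew t0 ->]]].
have iS := @rays_indep _ _ nsX s.
have /choice[p pP] : forall i, exists r, r \in rays s /\ tnth w i = ray_vec r.
  move=> i; have := mem_tnth i w; rewrite (perm_mem pw) => /mapP[r].
  by rewrite mem_enum => rs ->; exists r.
have pS i : p i \in rays s by have [] := pP i.
have pinj : injective p.
  have /tuple_uniqP uw : uniq w.
    rewrite (perm_uniq pw) map_inj_in_uniq ?enum_uniq // => r r'; rewrite !mem_enum.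
    exact: ray_vec_inj.
  by move=> i j pij; apply: uw; rewrite (pP i).2 (pP j).2 pij.
pose uw := \sum_i t i *: tnth w i.
have coordE i : pairing (dual ray_vec (rays s) (p i)) uw = t i.
  rewrite pairing_sumr (bigD1 i) //= pairingZr (pP i).2 dualP // eqxx mulr1.
  rewrite big1 ?addr0 // => j ji; rewrite pairingZr (pP j).2 dualP //.
  by rewrite (inj_eq pinj) eq_sym (negPf ji) mulr0.
have /vlineP[c cE] : uw \in <[u]>%VS by rewrite -Eu Ew memv_line.
have c0 : c != 0.
  apply: contraNneq (t0 (Ordinal k0)) => c0.
  by rewrite -coordE cE c0 scale0r pairing0r.
have tE i : t i = c * pairing (dual ray_vec (rays s) (p i)) u.
  by rewrite -coordE cE pairingZr.
split.
  move=> r rs; have : r \in (p @: [set: 'I_k])%SET.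
    suff -> : (p @: [set: 'I_k])%SET = rays s by [].
    apply/eqP; rewrite eqEcard card_imset // cardsT card_ord e leqnn andbT.
    by apply/fintype.subsetP => _ /imsetP[i _ ->].
  case/imsetP => i _ ->; apply: contraNneq (t0 i) => d0.
  by rewrite tE d0 mulr0.
rewrite (facet_ratioE _ _ e) -/(todd_ratio t) (eq_todd_ratio tE) todd_ratioZ //.
rewrite (todd_ratio_image (fun r => pairing (dual ray_vec (rays s) r) u) e pinj pS).
by rewrite -(todd_ratio_image _ e (@enum_at_inj _ _ _ e) (enum_atP e)).
Qed.

Variable C : set 'rV[rat]_n.
Hypotheses (cC : is_cone C) (XC : Defs.support X = C).

Lemma subdivision_complex : convex_complex ray_vec (fan_complex X).
Proof.
by apply: fan_convex_complex => // x y; rewrite XC; apply: is_coneD.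
Qed.

Lemma cspan_subdivision s : cdim (fan_cone s) = cdim C -> cspan (fan_cone s) = cspan C.
Proof.
move=> dE; apply/eqP; rewrite eqEdim -/(cdim C) -dE leqnn andbT.
have [_ min] := cspan_min (fan_is_cone s); apply: min => y sy /=.
by apply: cspan_mem => //; rewrite -XC; exists s.
Qed.

Lemma subdivision_facet_exists : exists s, cdim (fan_cone s) = cdim C.
Proof.
have cK := subdivision_complex.
have [S fS _] := csupport_facet cK (csupport0 cK).
have [/imsetP[s _ SE] _] := andP fS; exists s; apply/eqP.
by rewrite -(fan_facetE nsX s cC XC) -SE.
Qed.

(** The [k]-dimensional cones of the subdivision all have the span of [C], so a single vector [u]
    serves for all of them. *)
Lemma morelli_sum_facets k E u r : (0 < k)%N -> cdim C = k ->
  (E :&: cspan C)%VS = <[u]>%VS -> morelli_sum k X C E r ->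
  generic ray_vec (fan_complex X) u /\
  r = \sum_(S | facet ray_vec (fan_complex X) S) facet_ratio ray_vec S u.
Proof.
move=> k0 dC Eu [_ _ [val valP ->]].
have values s : cdim (fan_cone s) = k ->
    (forall i, i \in rays s -> pairing (dual ray_vec (rays s) i) u != 0) /\
    val s = facet_ratio ray_vec (rays s) u.
  move=> ds; apply: morelli_nonsingular_value (valP s ds) => //.
    by rewrite -cdim_rays.
  by rewrite cspan_subdivision // dC.
split.
  split; first by rewrite (fan_cover_span nsX cC XC); have := memv_line u;
    rewrite -Eu memv_cap => /andP[].
  move=> S i fS; have [/imsetP[s _ SE] _] := andP fS; subst S.
  have /eqP ds : cdim (fan_cone s) == k by rewrite -dC -(fan_facetE nsX s cC XC).
  by have [+ _] := values s ds; apply.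
rewrite (eq_bigl (mem (rays @: [set s | cdim (fan_cone s) == k])%SET)); last first.
  move=> S; apply/idP/imsetP => [fS|[s + ->]].
    have [/imsetP[s _ SE] _] := andP fS; exists s => //.
    by rewrite inE -dC -(fan_facetE nsX s cC XC) -SE.
  by rewrite inE -dC -(fan_facetE nsX s cC XC).
rewrite big_imset /=; last by move=> s t _ _ /(rays_inj nsX).
apply: eq_big => [s|s /eqP ds]; first by rewrite inE.
by have [_ ->] := values s ds.
Qed.

End MorelliValue.

Lemma morelli_sum_unique n k (C : set 'rV[rat]_n) E (X1 X2 : fan n) r1 r2 :
  is_cone C -> (0 < k)%N -> cdim C = k ->
  morelli_sum k X1 C E r1 -> morelli_sum k X2 C E r2 -> r1 = r2.
Proof.
move=> cC k0 dC ms1 ms2; have [XC1 ns1 [val valP _]] := ms1; have [XC2 ns2 _] := ms2.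
(* A full-dimensional cone of the first subdivision supplies the line in which [E] meets the span of
   [C]; its spanning vector serves both sums. *)
have [s ds] := subdivision_facet_exists ns1 cC XC1; rewrite dC in ds.
have [w [t [_ Ew _ _]]] := valP s ds.
rewrite (cspan_subdivision cC XC1) ?ds // in Ew.
have [g1 ->] := morelli_sum_facets ns1 cC XC1 k0 dC Ew ms1.
have [g2 ->] := morelli_sum_facets ns2 cC XC2 k0 dC Ew ms2.
apply: facet_ratio_invariant => //.
- exact: subdivision_complex cC XC1.
- exact: subdivision_complex cC XC2.
- exact: fan_unimodular cC XC1.
- exact: fan_unimodular cC XC2.
- by rewrite !csupport_fan // XC1 XC2.
Qed.

Theorem corollary2 (n : nat) (F : nat -> {vspace 'rV[rat]_n}) (k : nat)
    (sigma : set 'rV[rat]_n) (mu : rat) :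
  complete_flag F ->
  is_cone sigma ->
  (1 <= k)%N ->
  cdim sigma = k ->
  in_domain F sigma ->
  is_todd_measure F sigma mu ->
  is_morelli_value k sigma (F (n - k + 1)%N) mu.
Proof.
move=> flagF cS k0 dS _ [X [X' [s [mul [sE [subX nsX'] domX' mulP ->]]]]].
have [t0 t0s _] := subdivision_restricts subX (is_cone0 (fan_is_cone s)).
have inh : (0 < #|restricted_index X' sigma|)%N.
  apply/card_gt0P; have t0S : `[< fan_cone t0 `<=` sigma >] by rewrite -sE; apply/asboolP.
  by exists (Sub t0 t0S).
pose Y := restricted_fan inh.
have nsY : nonsingular_fan Y by apply: restricted_nonsingular.
have YS : Defs.support Y = sigma.
  apply/seteqP; split=> v; first by move=> [y yv]; apply: (asboolP _ (valP y)).
  rewrite -{1}sE => /(subdivision_restricts subX)[t ts tv].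
  have tS : `[< fan_cone t `<=` sigma >] by rewrite -sE; apply/asboolP.
  by exists (Sub t tS).
(* One Morelli sum with this value is enough, since any other agrees with it. *)
suff ms : morelli_sum k Y sigma (F (n - k + 1)%N) (pushforward X (todd_class mul) s).
  split; first by exists Y, (pushforward X (todd_class mul) s).
  move=> X'' r ms''; exact: morelli_sum_unique cS k0 dS ms'' ms.
split=> //; exists (fun y => todd_class mul (val y)) => [y dy|].
  have e : #|rays (val y)| = k by rewrite -(cdim_rays nsX').
  have line := flag_line flagF nsX' domX' (_ : 0 < #|rays (val y)|)%N.
  rewrite e in line.
  rewrite (todd_class_coef flagF nsX' domX' mulP e).
  have -> : todd_ratio (fun i : 'I_k => flag_coord F (val y) (enum_at e i)) =
      facet_ratio (@ray_vec n X') (rays (val y)) (flag_vec F (val y)).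
    rewrite (facet_ratioE _ _ e); apply: eq_todd_ratio => i.
    by rewrite /flag_coord enum_atP.
  apply: (morelli_nonsingular_exists nsX' e (line k0)) => i iy.
  by have := flag_coord_neq0 flagF nsX' domX' iy; rewrite /flag_coord iy.
(* In the push-forward, the condition that [sigma] be the smallest cone containing [s'] follows from
   equality of dimensions. *)
rewrite ffunE.
rewrite (eq_bigl (fun s' : X' => `[< fan_cone s' `<=` sigma >] && (cdim (fan_cone s')
  == k))).
  exact: (big_sub_cond (fun s' : X' => `[< fan_cone s' `<=` sigma >]) (fun s' => cdim
    (fan_cone s') == k)).
move=> s' /=; rewrite sE dS; apply/asboolP/andP => [[sub _ ->]|[/asboolP sub /eqP ds']].
  by split=> //; apply/asboolP.
(* The functional cutting the intersection with [t] out of [sigma] vanishes on the rays of [s'],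
   hence on their span, which is that of [sigma]; so [sigma] lies in [t]. *)
split=> // t s't x Sx; have [m mge0 mE] := fan_inter s t.
have cspanE : cspan (fan_cone s') = cspan sigma.
  apply/eqP; rewrite eqEdim -/(cdim sigma) -/(cdim _) ds' dS leqnn andbT.
  have [_ min] := cspan_min (fan_is_cone s'); apply: min => y s'y /=.
  by apply: cspan_mem => //; apply: sub.
have : (fan_cone s `&` [set y | pairing m y = 0]) x; last by rewrite -mE => -[].
split; first by rewrite sE.
have : x \in cspan (fan_cone s') by rewrite cspanE cspan_mem.
rewrite /= cspan_rays // => xs'.
rewrite (pairing_sspan m (@rays_indep _ _ nsX' s') xs') big1 // => i is'.
have s'i : fan_cone s' (ray_vec i).
  by apply: (raysP is'); apply: ray_vec_mem nsX' _ (rays_is_ray is').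
have : (fan_cone s `&` fan_cone t) (ray_vec i) by split; [rewrite sE;
  apply: sub | apply: s't].
by rewrite mE => -[_ /= ->]; rewrite mulr0.
Qed.
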